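(* Let $0<m\le 1$, $0<p\le 1$, $1<q<\infty$, and let $b\in\mathcal W(0,\infty)$ be non-increasing on $(0,\infty)$ and such that $B(t):=\int_0^t b(s)\,ds$ satisfies $0<B(t)<\infty$ for every $t\in(0,\infty)$. Suppose that $u\in\mathcal W(0,\infty)\cap C(0,\infty)$, $v\in\mathcal W_{m,p}(0,\infty)$ and $w\in\mathcal W(0,\infty)$. Let $$K:=\sup_{f\in\mathfrak M(\mathbb R^n)}\frac{\Big(\int_0^\infty [T_{u,b}f^*(x)]^q w(x)\,dx\Big)^{1/q}}{\Big(\int_0^\infty\big(\int_0^x[f^*(\tau)]^p\,d\tau\big)^{m/p}v(x)\,dx\Big)^{1/m}} .$$ Then $$\begin{aligned}K\approx{}&\sup_{t\in(0,\infty)}\frac{1}{v_1(t)^{1/m}}\Big(\int_0^t\Big(\sup_{\tau\in[x,t]}u(\tau)^q\Big)w(x)\,dx\Big)^{1/q}\\&+\sup_{t\in(0,\infty)}\frac{B(t)}{v_1(t)^{1/m}}\Big(\sup_{\tau\in[t,\infty)}\frac{u(\tau)}{B(\tau)}\Big)\Big(\int_0^t w(x)\,dx\Big)^{1/q}\\&+\sup_{t\in(0,\infty)}\frac{B(t)}{v_1(t)^{1/m}}\Big(\int_t^\infty\Big(\sup_{\tau\in[x,\infty)}\Big(\frac{u(\tau)}{B(\tau)}\Big)^q\Big)w(x)\,dx\Big)^{1/q}.\end{aligned}$$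
   Context: $\mathfrak M(\mathbb R^n)$ is the set of Lebesgue measurable functions on $\mathbb R^n$. The non-increasing rearrangement of $f$ is $f^*(t)=\inf\{\lambda\ge 0: |\{x\in\mathbb R^n:|f(x)|>\lambda\}|\le t\}$. $\mathcal W(0,\infty)$ is the set of weights, i.e. locally integrable non-negative functions on $(0,\infty)$; $C(0,\infty)$ is the set of continuous functions on $(0,\infty)$. For a non-negative measurable $g$ on $(0,\infty)$, $$(T_{u,b}g)(t):=\sup_{\tau\in[t,\infty)}\frac{u(\tau)}{B(\tau)}\int_0^\tau g(s)b(s)\,ds,\qquad t\in(0,\infty).$$ $\mathcal W_{m,p}(0,\infty)$ is the set of weights $v$ on $(0,\infty)$ such that $\int_0^t v(s)s^{m/p}\,ds+\int_t^\infty v(s)\,ds<\infty$ for all $t\in(0,\infty)$ and $\int_0^1 v(s)\,ds=\int_1^\infty v(s)s^{m/p}\,ds=\infty$. For such $v$, $$v_1(t):=\int_0^t v(s)s^{m/p}\,ds+t^{m/p}\int_t^\infty v(s)\,ds.$$ $X\approx Y$ means $X\le\lambda Y$ and $Y\le\lambda X$ for some finite constant $\lambda>0$ depending only on inessential parameters (here the exponents $m,p,q$), so that one side is finite if and only if the other is. Conventions: $0\cdot\infty=\infty/\infty=0/0=0$. *)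

(* Defs.v *)
From HB Require Import structures.
From mathcomp Require Import all_boot all_order all_algebra.
From mathcomp Require Import all_classical all_reals all_analysis measurable_realfun.

Set Implicit Arguments.
Unset Strict Implicit.
Unset Printing Implicit Defensive.

Import Order.TTheory GRing.Theory Num.Theory.
Import numFieldNormedType.Exports.

Local Open Scope classical_set_scope.
Local Open Scope ring_scope.
Local Open Scope ereal_scope.

(* On [\bar R] the library has [0 * +oo = 0], [0^-1 = +oo] and [+oo^-1 = 0],
   hence [0 / 0 = +oo / +oo = 0]; for [r != 0], [+oo `^ r = +oo].

   On the line, measurability of weights and integrals refer to
   [completed_lebesgue_measure], whose sigma-algebra consists of the Lebesgue
   measurable sets; [lebesgue_measure] is restricted to the Borel sets. *)

Section LebesgueRn.
Context {R : realType} (n : nat).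
Implicit Types (a c x : 'rV[R]_n) (A : set 'rV[R]_n).

Definition box a c : set 'rV[R]_n :=
  [set x | forall i, (a ord0 i < x ord0 i <= c ord0 i)%R].

Definition box_volume a c : R :=
  (\prod_(i < n) Num.max (c ord0 i - a ord0 i) 0)%R.

Definition lebesgue_outer A : \bar R :=
  ereal_inf [set \sum_(0 <= k <oo) (box_volume (F k).1 (F k).2)%:E
            | F in [set F : nat -> 'rV[R]_n * 'rV[R]_n
                   | A `<=` \bigcup_k box (F k).1 (F k).2]].

(* Lebesgue measurable sets are the Caratheodory measurable sets of
   [lebesgue_outer], and on them [lebesgue_outer] is the Lebesgue measure. *)
Definition lebesgue_measurable_fun (f : 'rV[R]_n -> \bar R) : Prop :=
  forall Y : set (\bar R), measurable Y ->
    lebesgue_outer.-caratheodory (f @^-1` Y).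

Definition rearrangement (f : 'rV[R]_n -> \bar R) (t : R) : \bar R :=
  ereal_inf [set l%:E | l in
    [set l : R | (0 <= l)%R /\ lebesgue_outer [set x | l%:E < `|f x|] <= t%:E]].

End LebesgueRn.

Section Weights.
Context {R : realType}.
Implicit Types (b u v w : R -> R) (g : R -> \bar R) (m p q t x : R).

(* [caratheodory_type (mu_ext (wlength idfun))] is [R] with the sigma-algebra
   of [completed_lebesgue_measure]. Weights live on (0, +oo); their values
   elsewhere are irrelevant. *)
Definition weight w : Prop :=
  [/\ measurable_fun
        (`]0%R, +oo[%classic : set (caratheodory_type (mu_ext (wlength idfun))))
        w,
      forall x, (0 < x)%R -> (0 <= w x)%R
    & forall K : set R, K `<=` `]0%R, +oo[%classic -> compact K ->
        \int[completed_lebesgue_measure]_(x in K) `|w x|%:E < +oo].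

Definition primitive b t : \bar R :=
  \int[completed_lebesgue_measure]_(s in `]0%R, t[) (b s)%:E.

Definition Tub u b g t : \bar R :=
  ereal_sup [set (u tau)%:E / primitive b tau *
      \int[completed_lebesgue_measure]_(s in `]0%R, tau[) (g s * (b s)%:E)
    | tau in `[t, +oo[%classic].

Definition Wmp m p v : Prop :=
  [/\ weight v,
      forall t, (0 < t)%R ->
        \int[completed_lebesgue_measure]_(s in `]0%R, t[)
          (v s * s `^ (m / p))%:E
        + \int[completed_lebesgue_measure]_(s in `]t, +oo[) (v s)%:E < +oo,
      \int[completed_lebesgue_measure]_(s in `]0%R, 1%R[) (v s)%:E = +oo
    & \int[completed_lebesgue_measure]_(s in `]1%R, +oo[)
        (v s * s `^ (m / p))%:E = +oo].

Definition v1 m p v t : \bar R :=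
  \int[completed_lebesgue_measure]_(s in `]0%R, t[) (v s * s `^ (m / p))%:E
  + (t `^ (m / p))%:E *
    \int[completed_lebesgue_measure]_(s in `]t, +oo[) (v s)%:E.

(* The functions [f] may take infinite values. *)
Definition bestK (n : nat) m p q b u v w : \bar R :=
  ereal_sup [set
    (\int[completed_lebesgue_measure]_(x in `]0%R, +oo[)
       (Tub u b (rearrangement f) x `^ q * (w x)%:E)) `^ q^-1
    / (\int[completed_lebesgue_measure]_(x in `]0%R, +oo[)
         ((\int[completed_lebesgue_measure]_(tau in `]0%R, x[)
             (rearrangement f tau `^ p)) `^ (m / p) * (v x)%:E)) `^ m^-1
    | f in [set f : 'rV[R]_n -> \bar R | lebesgue_measurable_fun f]].

(* For [0 < lam], this forces [X] and [Y] to be finite simultaneously. *)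
Definition equiv_with (lam : R) (X Y : \bar R) : Prop :=
  X <= lam%:E * Y /\ Y <= lam%:E * X.

End Weights.

(* Main.v *)
Require Import Defs.
From HB Require Import structures.
From mathcomp Require Import all_boot all_order all_algebra.
From mathcomp Require Import all_classical all_reals all_analysis measurable_realfun.
From mathcomp Require Import ring lra.
Import Order.TTheory GRing.Theory Num.Theory.
Import numFieldNormedType.Exports.
Local Open Scope classical_set_scope.
Local Open Scope ring_scope.
Local Open Scope ereal_scope.
Set Implicit Arguments.
Unset Strict Implicit.

(** For a non-increasing [g >= 0] on (0, +oo) let [N g] be the weighted
    [L^q]-norm of [T g] and let [S g] be the norm
    [(int (int_0^x g^p)^(m/p) v(x) dx)^(1/m)], so that [K] is the supremum of
    [N g / S g] over rearrangements [g].  The point is that characteristic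
    functions [e_t] of (0, t) already give [K] up to a factor 2.

    The operator [T] is sublinear and [q >= 1], hence Minkowski's inequality
    makes [N] subadditive ([NnormD_le]).  The functional [S] is an [L^m]-norm of
    [L^p]-norms with [m, p <= 1], and for such exponents Minkowski's inequality
    is reversed: [S] is superadditive ([SnormD_ge]).  So a bound
    [N e_t <= C * S e_t] for all [t] passes to nonnegative combinations of the
    [e_t]:  [N (sum c_i e_i) <= sum c_i N e_i <= C sum c_i S e_i
    <= C S (sum c_i e_i)].  The dyadic layers of a non-increasing [g], i.e. the
    sums of [2^k 1_{g > 2^k}] over finitely many integers [k], are such
    combinations; they increase to a function between [g] and [2 g], and monotone
    convergence gives [N g <= 2 C S g] ([Nnorm_le_Snorm]).

    For the functions [e_t] everything is explicit.  One has
    [S e_t = v_1(t)^(1/m)] ([Snorm_step]), while [T e_t x] is the larger of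
    [sup_{[x, t]} u] and [B(t) sup_{[t, oo)} u/B] for [x < t], and
    [B(t) sup_{[x, oo)} u/B] for [x >= t].  Hence [N e_t / S e_t] is at most
    the sum of the three quantities of the statement at [t]
    ([Nnorm_step_le]) and at least each of them ([head_sup_le_Nnorm],
    [head_le_Nnorm], [tail_sup_le_Nnorm]).

    Finally [e_t] is a rearrangement: that of the indicator of a box of volume
    [t] ([exists_rearrangement_step]).  This rests on two facts on
    the outer measure of R^n: boxes are Caratheodory measurable, and a
    countable cover of a box by boxes has at least its volume. *)

(** * Powers of extended reals and the two Minkowski inequalities *)

Section powers.
Local Open Scope convex_scope.
Context {R : realType}.

Lemma powR_mix_le (q a c X Y : R) : (1 <= q)%R -> (0 <= a)%R -> (0 <= c)%R ->
  (a + c = 1)%R -> (0 <= X)%R -> (0 <= Y)%R ->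
  ((a * X + c * Y) `^ q <= a * X `^ q + c * Y `^ q)%R.
Proof.
move=> q1 a0 c0 ac X0 Y0.
have a1 : (a <= 1)%R by lra.
have cE : unstable.onem a = c by rewrite /unstable.onem; lra.
have h : (((X : R^o) <| Itv01 a0 a1 |> (Y : R^o))%R `^ q <=
    ((X `^ q : R^o) <| Itv01 a0 a1 |> (Y `^ q : R^o)))%R.
  by apply: (convex_powR q1); rewrite inE/= in_itv/= andbT.
by move: h; rewrite !convRE/= cE.
Qed.

(** Concavity of [x^r] is convexity of [x^(1/r)] read at the points [X^r],
    [Y^r]. *)
Lemma powR_mix_ge (r a c X Y : R) : (0 < r)%R -> (r <= 1)%R ->
  (0 <= a)%R -> (0 <= c)%R -> (a + c = 1)%R -> (0 <= X)%R -> (0 <= Y)%R ->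
  (a * X `^ r + c * Y `^ r <= (a * X + c * Y) `^ r)%R.
Proof.
move=> r0 r1 a0 c0 ac X0 Y0.
have rV1 : (1 <= r^-1)%R by rewrite invf_ge1.
have := @powR_mix_le r^-1 a c (X `^ r) (Y `^ r) rV1 a0 c0 ac
  (powR_ge0 _ _) (powR_ge0 _ _).
rewrite -!powRrM divff ?gt_eqF// !powRr1// => h.
have := ge0_ler_powR (ltW r0) _ _ h.
rewrite !nnegrE powR_ge0 addr_ge0 ?mulr_ge0 ?powR_ge0// -powRrM.
by rewrite mulVf ?gt_eqF// powRr1 ?addr_ge0 ?mulr_ge0 ?powR_ge0//; exact.
Qed.

Lemma le_poweR (r : R) (x y : \bar R) : (0 <= r)%R -> 0 <= x -> x <= y ->
  x `^ r <= y `^ r.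
Proof.
move=> r0 x0 xy; apply: gt0_ler_poweR => //; rewrite in_itv/= ?leey ?andbT//.
exact: le_trans xy.
Qed.

Lemma poweRK (r : R) (x : \bar R) : r != 0%R -> 0 <= x -> (x `^ r) `^ r^-1 = x.
Proof. by move=> r0 x0; rewrite -poweRrM mulfV// poweRe1. Qed.

Lemma poweRVK (r : R) (x : \bar R) : r != 0%R -> 0 <= x -> (x `^ r^-1) `^ r = x.
Proof. by move=> r0 x0; rewrite -poweRrM mulVf// poweRe1. Qed.

(** Because of this adjunction, taking powers commutes with suprema, also when
    they are infinite. *)
Lemma poweR_le_galois (r : R) (x y : \bar R) : (0 < r)%R -> 0 <= x -> 0 <= y ->
  (x `^ r <= y) = (x <= y `^ r^-1).
Proof.
move=> r0 x0 y0; apply/idP/idP => h.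
  rewrite -(@poweRK r x) ?gt_eqF//; apply: le_poweR => //.
    by rewrite invr_ge0 ltW.
  exact: poweR_ge0.
rewrite -(@poweRVK r y) ?gt_eqF//.
by apply: le_poweR => //; exact: ltW.
Qed.

(** Coefficients of the pointwise convexity inequality behind Minkowski's:
    write [x + y] as the convex combination of [x (a + c) / a] and
    [y (a + c) / c] with weights [a / (a + c)] and [c / (a + c)].  The numbers
    [a] and [c] will be (bounds on) the norms of the two summands. *)
Definition mix_coef (r a c : R) : R := (a / (a + c) * ((a + c) / a) `^ r)%R.

Lemma mix_coef_gt0 (r a c : R) : (0 < a)%R -> (0 < c)%R -> (0 < mix_coef r a c)%R.
Proof.
move=> a0 c0; rewrite mulr_gt0 ?divr_gt0 ?addr_gt0// powR_gt0//.
by rewrite divr_gt0// addr_gt0.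
Qed.

Lemma mix_coefM (r a c : R) : (0 < a)%R -> (0 < c)%R ->
  (mix_coef r a c * a `^ r = a / (a + c) * (a + c) `^ r)%R.
Proof.
move=> a0 c0; rewrite /mix_coef -mulrA -powRM ?divrK ?unitfE ?gt_eqF//.
- by rewrite divr_ge0 ?addr_ge0 ?ltW.
- exact: ltW.
Qed.

Lemma mix_coefD (r a c : R) : (0 < a)%R -> (0 < c)%R ->
  (mix_coef r a c * a `^ r + mix_coef r c a * c `^ r = (a + c) `^ r)%R.
Proof.
move=> a0 c0; rewrite !mix_coefM// (addrC c a) -!mulrDl divff ?mul1r//.
by rewrite gt_eqF// addr_gt0.
Qed.

Lemma poweRD_mix_le (q a c : R) (x y : \bar R) : (1 <= q)%R ->
  (0 < a)%R -> (0 < c)%R -> 0 <= x -> 0 <= y ->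
  (x + y) `^ q <= (mix_coef q a c)%:E * x `^ q + (mix_coef q c a)%:E * y `^ q.
Proof.
move=> q1 a0 c0; have q0 : q != 0%R by rewrite gt_eqF// (lt_le_trans _ q1).
have ac0 : (0 < a + c)%R by rewrite addr_gt0.
case: x y => [x| |]// [y| |]// x0 y0.
- rewrite -EFinD !poweR_EFin -!EFinM -EFinD lee_fin.
  have -> : (x + y = a / (a + c) * ((a + c) / a * x) +
                     c / (a + c) * ((a + c) / c * y))%R.
    by field; rewrite !gt_eqF.
  have a'0 : (0 <= a / (a + c))%R by rewrite divr_ge0// ltW.
  have c'0 : (0 <= c / (a + c))%R by rewrite divr_ge0// ltW.
  have ac1 : (a / (a + c) + c / (a + c) = 1)%R by rewrite -mulrDl divff// gt_eqF.
  have X0 : (0 <= (a + c) / a * x)%R by rewrite mulr_ge0// divr_ge0// ltW.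
  have Y0 : (0 <= (a + c) / c * y)%R by rewrite mulr_ge0// divr_ge0// ltW.
  apply: (le_trans (powR_mix_le q1 a'0 c'0 ac1 X0 Y0)).
  rewrite [X in (a / _ * X)%R]powRM ?divr_ge0 ?(ltW ac0) ?(ltW a0)//.
  rewrite [X in (c / _ * X)%R]powRM ?divr_ge0 ?(ltW ac0) ?(ltW c0)//.
  by rewrite /mix_coef !mulrA (addrC c a).
- by rewrite poweRyr// gt0_muley ?lte_fin ?mix_coef_gt0// poweR_EFin -EFinM
  addey// leey.
- by rewrite poweRyr// gt0_muley ?lte_fin ?mix_coef_gt0// poweR_EFin -EFinM
  addye// leey.
- by rewrite poweRyr// !gt0_muley ?lte_fin ?mix_coef_gt0// addye// leey.
Qed.

Lemma poweRD_mix_ge (r a c : R) (x y : \bar R) : (0 < r)%R -> (r <= 1)%R ->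
  (0 < a)%R -> (0 < c)%R -> 0 <= x -> 0 <= y ->
  (mix_coef r a c)%:E * x `^ r + (mix_coef r c a)%:E * y `^ r <= (x + y) `^ r.
Proof.
move=> r0 r1 a0 c0; have rn0 : r != 0%R by rewrite gt_eqF.
have ac0 : (0 < a + c)%R by rewrite addr_gt0.
case: x y => [x| |]// [y| |]// x0 y0.
- rewrite -(EFinD x y) !poweR_EFin -!EFinM -EFinD lee_fin.
  have -> : (x + y = a / (a + c) * ((a + c) / a * x) +
                     c / (a + c) * ((a + c) / c * y))%R.
    by field; rewrite !gt_eqF.
  have a'0 : (0 <= a / (a + c))%R by rewrite divr_ge0// ltW.
  have c'0 : (0 <= c / (a + c))%R by rewrite divr_ge0// ltW.
  have ac1 : (a / (a + c) + c / (a + c) = 1)%R by rewrite -mulrDl divff// gt_eqF.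
  have X0 : (0 <= (a + c) / a * x)%R by rewrite mulr_ge0// divr_ge0// ltW.
  have Y0 : (0 <= (a + c) / c * y)%R by rewrite mulr_ge0// divr_ge0// ltW.
  apply: (le_trans _ (powR_mix_ge r0 r1 a'0 c'0 ac1 X0 Y0)).
  rewrite [X in (a / _ * X)%R]powRM ?divr_ge0 ?(ltW ac0) ?(ltW a0)//.
  rewrite [X in (c / _ * X)%R]powRM ?divr_ge0 ?(ltW ac0) ?(ltW c0)//.
  by rewrite /mix_coef !mulrA (addrC c a).
- by rewrite addey// poweRyr// leey.
- by rewrite addye// poweRyr// leey.
- by rewrite addye// poweRyr// leey.
Qed.

End powers.

Section wnorm.
Context d (T : measurableType d) (R : realType).
Variables (mu : {measure set T -> \bar R}) (D : set T) (w : T -> R).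
Hypothesis mD : measurable D.
Hypothesis mw : measurable_fun D w.
Hypothesis w0 : forall x, D x -> (0 <= w x)%R.
Implicit Types F G : T -> \bar R.

Definition wint (r : R) F : \bar R := \int[mu]_(x in D) (F x `^ r * (w x)%:E).
Definition wnorm (r : R) F : \bar R := wint r F `^ r^-1.

Definition nneg_measurable F := measurable_fun D F /\ forall x, D x -> 0 <= F x.

Lemma nneg_measurableD F G : nneg_measurable F -> nneg_measurable G ->
  nneg_measurable (fun x => F x + G x).
Proof.
move=> [mF F0] [mG G0]; split; first exact: emeasurable_funD.
by move=> x Dx; rewrite adde_ge0 ?F0 ?G0.
Qed.

Lemma nneg_measurableZ (k : R) F : (0 <= k)%R -> nneg_measurable F ->
  nneg_measurable (fun x => k%:E * F x).
Proof.
move=> k0 [mF F0]; split.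
  by apply: emeasurable_funM => //; exact: measurable_cst.
by move=> x Dx; rewrite mule_ge0 ?F0.
Qed.

Lemma nneg_measurable_integrand (r : R) F : nneg_measurable F ->
  nneg_measurable (fun x => F x `^ r * (w x)%:E).
Proof.
move=> [mF F0]; split.
  apply: emeasurable_funM; last exact/measurable_EFinP.
  exact: (measurableT_comp (measurable_poweR r)).
by move=> x Dx; rewrite mule_ge0 ?poweR_ge0// lee_fin w0.
Qed.

Lemma wint_ge0 (r : R) F : 0 <= wint r F.
Proof.
by apply: integral_ge0 => x Dx; rewrite mule_ge0 ?poweR_ge0// lee_fin w0.
Qed.

Lemma wnorm_ge0 (r : R) F : 0 <= wnorm r F. Proof. exact: poweR_ge0. Qed.

Lemma le_wint (r : R) F G : (0 <= r)%R -> nneg_measurable F -> nneg_measurable G ->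
  (forall x, D x -> F x <= G x) -> wint r F <= wint r G.
Proof.
move=> r0 hF hG FG; apply: ge0_le_integral => //.
- by case: (nneg_measurable_integrand r hF).
- by case: (nneg_measurable_integrand r hF).
- by case: (nneg_measurable_integrand r hG).
- move=> x Dx; rewrite lee_wpmul2r// ?lee_fin ?w0//.
  by apply: le_poweR => //; [exact: hF.2|exact: FG].
Qed.

Lemma le_wnorm (r : R) F G : (0 <= r)%R -> nneg_measurable F -> nneg_measurable G ->
  (forall x, D x -> F x <= G x) -> wnorm r F <= wnorm r G.
Proof.
move=> r0 hF hG FG; apply: le_poweR; rewrite ?invr_ge0 ?wint_ge0//.
exact: le_wint.
Qed.

Lemma wnormZ (r k : R) F : (0 < r)%R -> (0 <= k)%R -> nneg_measurable F ->
  wnorm r (fun x => k%:E * F x) = k%:E * wnorm r F.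
Proof.
move=> r0 k0 hF; rewrite /wnorm /wint.
have -> : \int[mu]_(x in D) ((k%:E * F x) `^ r * (w x)%:E) =
    k%:E `^ r * wint r F.
  rewrite poweR_EFin -ge0_integralZl_EFin ?powR_ge0//.
  - apply: eq_integral => x; rewrite inE => Dx.
    by rewrite poweRM ?lee_fin//; [rewrite muleA|exact: hF.2].
  - exact: (nneg_measurable_integrand r hF).2.
  - exact: (nneg_measurable_integrand r hF).1.
by rewrite poweRM ?poweR_ge0 ?wint_ge0// poweRK// ?gt_eqF.
Qed.

Lemma wint_mix (r a c : R) F G : (0 < a)%R -> (0 < c)%R -> nneg_measurable F ->
  nneg_measurable G ->
  \int[mu]_(x in D)
    (((mix_coef r a c)%:E * F x `^ r + (mix_coef r c a)%:E * G x `^ r) * (w x)%:E) =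
  (mix_coef r a c)%:E * wint r F + (mix_coef r c a)%:E * wint r G.
Proof.
move=> a0 c0 hF hG; rewrite /wint.
have m1 := ltW (mix_coef_gt0 r a0 c0); have m2 := ltW (mix_coef_gt0 r c0 a0).
have nF := nneg_measurable_integrand r hF; have nG := nneg_measurable_integrand r hG.
rewrite -(ge0_integralZl_EFin mu mD nF.2 nF.1 m1).
rewrite -(ge0_integralZl_EFin mu mD nG.2 nG.1 m2).
have nmF := nneg_measurableZ m1 nF; have nmG := nneg_measurableZ m2 nG.
rewrite -(ge0_integralD mu mD nmF.2 nmF.1 nmG.2 nmG.1).
apply: eq_integral => x; rewrite inE => Dx.
by rewrite ge0_muleDl ?mule_ge0 ?poweR_ge0 ?lee_fin ?w0// !muleA.
Qed.

(** Integrating the convexity inequality for the bounds [a] and [c] gives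
    [(a + c)^q] on the right.  Positive bounds, rather than the norms
    themselves, avoid the case of a vanishing norm. *)
Lemma wnormD_le_real (q a c : R) F G : (1 <= q)%R -> (0 < a)%R -> (0 < c)%R ->
  nneg_measurable F -> nneg_measurable G -> wnorm q F <= a%:E -> wnorm q G <= c%:E ->
  wnorm q (fun x => F x + G x) <= (a + c)%:E.
Proof.
move=> q1 a0 c0 hF hG; have q0 : (0 < q)%R by exact: lt_le_trans q1.
have qV0 : (0 < q^-1)%R by rewrite invr_gt0.
have ac0 := addr_gt0 a0 c0.
rewrite /wnorm !poweR_le_galois ?wint_ge0 ?lee_fin ?(ltW a0) ?(ltW c0) ?(ltW ac0)//.
rewrite invrK => hFa hGc.
apply: (@le_trans _ _
    ((mix_coef q a c)%:E * wint q F + (mix_coef q c a)%:E * wint q G)).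
  rewrite -wint_mix//; apply: ge0_le_integral => //.
  - exact: (nneg_measurable_integrand q (nneg_measurableD hF hG)).2.
  - exact: (nneg_measurable_integrand q (nneg_measurableD hF hG)).1.
  - apply: emeasurable_funM; last exact/measurable_EFinP.
    by apply: emeasurable_funD; apply: emeasurable_funM => //;
      apply: (measurableT_comp (measurable_poweR q)); [exact: hF.1|exact: hG.1].
  - move=> x Dx; rewrite lee_wpmul2r// ?lee_fin ?w0//.
    by apply: poweRD_mix_le => //; [exact: hF.2|exact: hG.2].
rewrite poweR_EFin -(mix_coefD q a0 c0) EFinD !EFinM leeD// lee_wpmul2l//.
- by rewrite lee_fin ltW// mix_coef_gt0.
- by rewrite lee_fin ltW// mix_coef_gt0.
Qed.

Lemma wnormD_le (q : R) F G : (1 <= q)%R -> nneg_measurable F -> nneg_measurable G ->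
  wnorm q (fun x => F x + G x) <= wnorm q F + wnorm q G.
Proof.
move=> q1 hF hG.
have := wnorm_ge0 q G; have := wnorm_ge0 q F.
case EF : (wnorm q F) => [a| |]// a0; last first.
  by rewrite addye ?leey// gt_eqF// (lt_le_trans _ (wnorm_ge0 _ _)).
case EG : (wnorm q G) => [c| |]// c0; last by rewrite addey ?leey.
apply/lee_addgt0Pr => e e0; rewrite -!EFinD (splitr e) addrACA.
have e20 : (0 < e / 2)%R by rewrite divr_gt0.
apply: wnormD_le_real => //; rewrite ?ltr_wpDl// ?EF ?EG lee_fin lerDl ltW//.
Qed.

(** For exponents at most 1 the pointwise inequality is reversed, and so is
    Minkowski's inequality.  If one of the norms is 0 or +oo the claim is mere
    monotonicity. *)
Lemma wnormD_ge (r : R) F G : (0 < r)%R -> (r <= 1)%R -> nneg_measurable F ->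
  nneg_measurable G ->
  wnorm r F + wnorm r G <= wnorm r (fun x => F x + G x).
Proof.
move=> r0 r1 hF hG; have hFG := nneg_measurableD hF hG.
have rn0 : r != 0%R by rewrite gt_eqF.
have leF : wnorm r F <= wnorm r (fun x => F x + G x).
  apply: le_wnorm => // [|x Dx]; first exact: ltW.
  by rewrite leeDl// hG.2.
have leG : wnorm r G <= wnorm r (fun x => F x + G x).
  apply: le_wnorm => // [|x Dx]; first exact: ltW.
  by rewrite leeDr// hF.2.
case EF : (wnorm r F) (wnorm_ge0 r F) leF => [a| |]// + leF; last first.
  by move=> _; rewrite [leRHS](_ : _ = +oo) ?leey//; apply/eqP; rewrite -leye_eq.
case EG : (wnorm r G) (wnorm_ge0 r G) leG => [c| |]// + leG.
rewrite !lee_fin le_eqVlt => /predU1P[<-|c0]; first by rewrite adde0.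
rewrite le_eqVlt => /predU1P[<-|a0]; first by rewrite add0e.
rewrite -EFinD -(@poweRK _ r (a + c)%:E)//; last by rewrite lee_fin addr_ge0// ltW.
apply: le_poweR; [by rewrite invr_ge0 ltW|exact: poweR_ge0|].
have iF : wint r F = (a `^ r)%:E by rewrite -poweR_EFin -EF poweRVK// wint_ge0.
have iG : wint r G = (c `^ r)%:E by rewrite -poweR_EFin -EG poweRVK// wint_ge0.
rewrite poweR_EFin -(mix_coefD r a0 c0) EFinD !EFinM -iF -iG -wint_mix//.
apply: ge0_le_integral => //.
- move=> x Dx; rewrite mule_ge0 ?lee_fin ?w0//.
  by rewrite adde_ge0// mule_ge0 ?poweR_ge0// lee_fin ltW// mix_coef_gt0.
- apply: emeasurable_funM; last exact/measurable_EFinP.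
  by apply: emeasurable_funD; apply: emeasurable_funM => //;
    apply: (measurableT_comp (measurable_poweR r)); [exact: hF.1|exact: hG.1].
- exact: (nneg_measurable_integrand r hFG).1.
- move=> x Dx; rewrite lee_wpmul2r// ?lee_fin ?w0//.
  by apply: poweRD_mix_ge => //; [exact: hF.2|exact: hG.2].
Qed.

End wnorm.

(** * Monotone convergence and Lebesgue measurability on the line *)

Section mct.
Context d (T : measurableType d) (R : realType).
Variables (mu : {measure set T -> \bar R}) (D : set T).
Hypothesis mD : measurable D.

(** The form of monotone convergence needed below: the limit function has only
    to lie below the supremum of the sequence. *)
Lemma integral_le_sup (F : T -> \bar R) (F_ : nat -> T -> \bar R) :
  nneg_measurable D F -> (forall n, nneg_measurable D (F_ n)) ->
  (forall x, D x -> {homo F_ ^~ x : n p / (n <= p)%N >-> n <= p}) ->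
  (forall x, D x -> F x <= ereal_sup (range (F_ ^~ x))) ->
  \int[mu]_(x in D) F x <= ereal_sup (range (fun n => \int[mu]_(x in D) F_ n x)).
Proof.
move=> hF hF_ nd le_sup.
have nd_int : nondecreasing_seq (fun n => \int[mu]_(x in D) F_ n x).
  move=> n p np; apply: ge0_le_integral => //.
  - exact: (hF_ n).2.
  - exact: (hF_ n).1.
  - exact: (hF_ p).1.
  - by move=> x Dx; exact: nd.
have cvx x : D x -> F_ ^~ x @ \oo --> ereal_sup (range (F_ ^~ x)).
  by move=> Dx; apply: ereal_nondecreasing_cvgn => n p; exact: nd.
have /cvg_lim <- // := ereal_nondecreasing_cvgn nd_int.
rewrite -monotone_convergence//.
- apply: ge0_le_integral => //.
  + exact: hF.2.
  + exact: hF.1.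
  + apply: (@emeasurable_fun_cvg _ _ _ D F_); first by move=> n; exact: (hF_ n).1.
    by move=> x Dx; rewrite (cvg_lim _ (cvx x Dx));
      [exact: cvx|exact: ereal_hausdorff].
  + by move=> x Dx; have /cvg_lim -> // := cvx x Dx; exact: le_sup.
- by move=> n; exact: (hF_ n).1.
- by move=> n x; exact: (hF_ n).2.
Qed.

End mct.

Section line.
Context {R : realType}.
Local Notation LT := (caratheodory_type (mu_ext (wlength (@idfun R)))).
Local Notation mu := (@completed_lebesgue_measure R).

Lemma interval_lebesgue_measurable (A : set R) :
  is_interval A -> measurable (A : set LT).
Proof. by move=> iA; apply: sub_caratheodory; exact: is_interval_measurable. Qed.

Lemma itv_lebesgue_measurable (i : interval R) : measurable ([set` i] : set LT).
Proof. by apply: interval_lebesgue_measurable; exact: interval_is_interval. Qed.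

Lemma completed_lebesgue_set1 (x : R) : mu [set x] = 0.
Proof. exact: (@lebesgue_measure_set1 R x). Qed.

Lemma set1_lebesgue_measurable (x : R) : measurable ([set x] : set LT).
Proof. by rewrite -set_itv1; exact: itv_lebesgue_measurable. Qed.

Lemma completed_lebesgue_itv0 (t : R) : (0 <= t)%R -> mu `]0%R, t[%classic = t%:E.
Proof.
move=> t0; have := @lebesgue_measure_itv R `]0%R, t[.
rewrite /= lte_fin => h; transitivity (@lebesgue_measure R `]0%R, t[%classic) => //.
rewrite h; case: ltgtP t0 => // [_|<-] _; by rewrite ?sube0//.
Qed.

Lemma nonincreasing_lebesgue_measurable (A : set R) (F : R -> \bar R) :
  is_interval A -> (forall x y, A x -> A y -> (x <= y)%R -> F y <= F x) ->
  measurable_fun (A : set LT) F.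
Proof.
move=> iA nF; apply: (measurability _ (ErealGenOInfty.measurableE R)).
move=> _ [_ [y ->] <-]; apply: interval_lebesgue_measurable.
move=> a b [Aa /= Fa] [Ab /= Fb] c /andP[ac cb].
have Ac : A c by apply: (iA a b) => //; rewrite ac cb.
split=> //=; move: Fa Fb; rewrite !in_itv/= !andbT => Fa Fb.
exact: (lt_le_trans Fb (nF _ _ Ac Ab cb)).
Qed.

Lemma nondecreasing_lebesgue_measurable (A : set R) (F : R -> \bar R) :
  is_interval A -> (forall x y, A x -> A y -> (x <= y)%R -> F x <= F y) ->
  measurable_fun (A : set LT) F.
Proof.
move=> iA nF; apply: (measurability _ (ErealGenOInfty.measurableE R)).
move=> _ [_ [y ->] <-]; apply: interval_lebesgue_measurable.
move=> a b [Aa /= Fa] [Ab /= Fb] c /andP[ac cb].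
have Ac : A c by apply: (iA a b) => //; rewrite ac cb.
split=> //=; move: Fa Fb; rewrite !in_itv/= !andbT => Fa Fb.
exact: (lt_le_trans Fa (nF _ _ Aa Ac ac)).
Qed.

Lemma integral_setD1_point (A : set LT) (F : LT -> \bar R) (t : R) :
  measurable A -> nneg_measurable A F ->
  \int[mu]_(x in A) F x = \int[mu]_(x in A `\ t) F x.
Proof.
move=> mA [mF F0]; apply: ge0_negligible_integral => //.
- exact: set1_lebesgue_measurable.
- exact: completed_lebesgue_set1.
Qed.

End line.

(** * The operator T on non-increasing functions *)

Section operators.
Context {R : realType}.
Local Notation LT := (caratheodory_type (mu_ext (wlength (@idfun R)))).
Local Notation mu := (@completed_lebesgue_measure R).
Local Notation D := (`]0%R, +oo[%classic : set R).
Implicit Types (g h : R -> \bar R) (k t x y : R).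

(** What is used of a rearrangement.  Only the values on (0, +oo) count, since
    all integrals are taken there. *)
Definition decreasing_nneg g :=
  (forall x, (0 < x)%R -> 0 <= g x) /\
  (forall x y, (0 < x)%R -> (x <= y)%R -> g y <= g x).

Lemma pos_itvP x : D x <-> (0 < x)%R.
Proof. by rewrite /= in_itv/= andbT. Qed.

Lemma oo_itvP x t : `]0%R, t[%classic x <-> (0 < x)%R /\ (x < t)%R.
Proof. by rewrite /= in_itv/=; split => [/andP[]|[-> ->]]. Qed.

Lemma decreasing_nneg_measurable g (A : set R) : is_interval A -> A `<=` D ->
  decreasing_nneg g -> nneg_measurable (A : set LT) g.
Proof.
move=> iA AD [g0 gd]; split.
  apply: nonincreasing_lebesgue_measurable => // x y Ax Ay xy.
  by apply: gd => //; apply/pos_itvP/AD.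
by move=> x /AD/pos_itvP; exact: g0.
Qed.

Lemma oo_sub_pos t : `]0%R, t[%classic `<=` D.
Proof. by move=> x /oo_itvP[x0 _]; apply/pos_itvP. Qed.

Lemma decreasing_nneg_measurable_oo g t : decreasing_nneg g ->
  nneg_measurable (`]0%R, t[%classic : set LT) g.
Proof.
by apply: decreasing_nneg_measurable => //;
  [exact: interval_is_interval|exact: oo_sub_pos].
Qed.

Lemma decreasing_nneg_measurable_pos g : decreasing_nneg g ->
  nneg_measurable (D : set LT) g.
Proof. by apply: decreasing_nneg_measurable => //; exact: interval_is_interval. Qed.

Lemma decreasing_nnegD g h : decreasing_nneg g -> decreasing_nneg h ->
  decreasing_nneg (fun x => g x + h x).
Proof.
move=> [g0 gd] [h0 hd]; split => [x x0|x y x0 xy].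
  by rewrite adde_ge0 ?g0 ?h0.
by rewrite leeD ?gd ?hd.
Qed.

Lemma decreasing_nnegZ k g : (0 <= k)%R -> decreasing_nneg g ->
  decreasing_nneg (fun x => k%:E * g x).
Proof.
move=> k0 [g0 gd]; split => [x x0|x y x0 xy].
  by rewrite mule_ge0 ?g0.
by rewrite lee_wpmul2l ?lee_fin// gd.
Qed.

Section averaging.
Variables (u b : R -> R).
Hypothesis wb : weight b.
Hypothesis wu : weight u.
Hypothesis B0 : forall t, (0 < t)%R -> 0 < primitive b t /\ primitive b t < +oo.

Lemma weight_measurable (a : R -> R) (A : set R) : weight a -> A `<=` D ->
  measurable (A : set LT) -> measurable_fun (A : set LT) a.
Proof.
move=> [ma _ _] AD mA; apply: measurable_funS ma => //.
exact: itv_lebesgue_measurable.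
Qed.

(** The inner integral of the operator, with [primitive b] as the case
    [g = 1]. *)
Definition wprim g t : \bar R := \int[mu]_(s in `]0%R, t[) (g s * (b s)%:E).

Lemma wprim_integrand_measurable g t : decreasing_nneg g ->
  nneg_measurable (`]0%R, t[%classic : set LT) (fun s => g s * (b s)%:E).
Proof.
move=> /(decreasing_nneg_measurable_oo t)[mg g0]; split.
  apply: emeasurable_funM; first exact: mg.
  apply/measurable_EFinP/(weight_measurable wb (@oo_sub_pos t)).
  exact: itv_lebesgue_measurable.
move=> x Ax; rewrite mule_ge0 ?g0// lee_fin.
by case: wb => _ b0 _; apply: b0; case/oo_itvP: Ax.
Qed.

Lemma wprim_ge0 g t : decreasing_nneg g -> 0 <= wprim g t.
Proof.
by move=> dg; apply: integral_ge0; exact: (wprim_integrand_measurable t dg).2.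
Qed.

Lemma wprimD g h t : decreasing_nneg g -> decreasing_nneg h ->
  wprim (fun x => g x + h x) t = wprim g t + wprim h t.
Proof.
move=> dg dh; rewrite /wprim.
have [mg g0] := wprim_integrand_measurable t dg.
have [mh h0] := wprim_integrand_measurable t dh.
rewrite -(@ge0_integralD _ LT R mu _ (itv_lebesgue_measurable _) _ _ g0 mg h0 mh).
apply: eq_integral => x; rewrite inE => /oo_itvP[x0 _].
by rewrite ge0_muleDl ?dg.1 ?dh.1.
Qed.

Lemma wprimZ k g t : (0 <= k)%R -> decreasing_nneg g ->
  wprim (fun x => k%:E * g x) t = k%:E * wprim g t.
Proof.
move=> k0 dg; rewrite /wprim; have [mg g0] := wprim_integrand_measurable t dg.
rewrite -(@ge0_integralZl_EFin _ LT R mu _ (itv_lebesgue_measurable _) _ g0 mg _ k0).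
by apply: eq_integral => x _; rewrite muleA.
Qed.

Lemma le_wprim g h t : decreasing_nneg g -> decreasing_nneg h ->
  (forall x, (0 < x)%R -> g x <= h x) -> wprim g t <= wprim h t.
Proof.
move=> dg dh gh; apply: ge0_le_integral.
- exact: itv_lebesgue_measurable.
- exact: (wprim_integrand_measurable t dg).2.
- exact: (wprim_integrand_measurable t dg).1.
- exact: (wprim_integrand_measurable t dh).1.
- move=> x /oo_itvP[x0 xt]; rewrite lee_wpmul2r ?gh// lee_fin.
  by case: wb => _ b0 _; exact: b0.
Qed.

Lemma ereal_sup_mulr (I : Type) (F : I -> \bar R) (i0 : I) (y : \bar R) k :
  (0 <= k)%R -> 0 <= y -> y <= ereal_sup (range F) ->
  y * k%:E <= ereal_sup (range (fun i => F i * k%:E)).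
Proof.
move=> k0 y0 ys; have := @ereal_supZl R (range F) k _ k0.
rewrite image_comp/= => h.
rewrite (_ : (fun i => F i * k%:E) = (fun i => k%:E * F i)); last first.
  by apply/funext => i; rewrite muleC.
rewrite h; last by apply/set0P; exists (F i0), i0.
by rewrite muleC lee_wpmul2l// lee_fin.
Qed.

Lemma wprim_sup g (g_ : nat -> R -> \bar R) t :
  decreasing_nneg g -> (forall n, decreasing_nneg (g_ n)) ->
  (forall x, (0 < x)%R -> {homo g_ ^~ x : n p / (n <= p)%N >-> n <= p}) ->
  (forall x, (0 < x)%R -> g x <= ereal_sup (range (g_ ^~ x))) ->
  wprim g t <= ereal_sup (range (fun n => wprim (g_ n) t)).
Proof.
move=> dg dg_ nd le_sup; have b0 : forall x, (0 < x)%R -> (0 <= b x)%R by case: wb.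
apply: (@integral_le_sup _ LT R mu _ _
   (fun s => g s * (b s)%:E) (fun n s => g_ n s * (b s)%:E)).
- exact: itv_lebesgue_measurable.
- exact: wprim_integrand_measurable.
- by move=> n; exact: wprim_integrand_measurable.
- move=> x /oo_itvP[x0 _] n p np.
  by rewrite lee_wpmul2r ?lee_fin ?b0// nd.
- move=> x /oo_itvP[x0 _].
  by apply: (@ereal_sup_mulr _ (g_ ^~ x) 0%N); rewrite ?b0 ?dg.1// le_sup.
Qed.

(** The quotient [u / B] as a real number, so that multiplication by it
    commutes with suprema. *)
Definition u_over_B t : R := (u t / fine (primitive b t))%R.

Lemma fine_primitive_gt0 t : (0 < t)%R -> (0 < fine (primitive b t))%R.
Proof. by move=> t0; rewrite fine_gt0//; case: (B0 t0) => -> ->. Qed.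

Lemma fineK_primitive t : (0 < t)%R -> (fine (primitive b t))%:E = primitive b t.
Proof.
move=> t0; rewrite fineK// ge0_fin_numE ?(B0 t0).2//.
by rewrite ltW// (B0 t0).1.
Qed.

Lemma u_over_BE t : (0 < t)%R -> (u t)%:E / primitive b t = (u_over_B t)%:E.
Proof.
move=> t0; rewrite -fineK_primitive// inver gt_eqF ?fine_primitive_gt0//.
Qed.

Lemma u_over_B_ge0 t : (0 < t)%R -> (0 <= u_over_B t)%R.
Proof.
move=> t0; rewrite divr_ge0//; first by case: wu => _ + _; apply.
by rewrite ltW// fine_primitive_gt0.
Qed.

Lemma cy_pos x t : (0 < x)%R -> `[x, +oo[%classic t -> (0 < t)%R.
Proof. by move=> x0; rewrite /= in_itv/= andbT; exact: lt_le_trans. Qed.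

Lemma Tub_ubound g x t : (0 < x)%R -> (x <= t)%R ->
  (u_over_B t)%:E * wprim g t <= Tub u b g x.
Proof.
move=> x0 xt; apply: ereal_sup_ubound; exists t.
  by rewrite /= in_itv/= xt.
by rewrite u_over_BE// (lt_le_trans x0).
Qed.

Lemma Tub_le_ub g x (y : \bar R) : (0 < x)%R ->
  (forall t, (x <= t)%R -> (u_over_B t)%:E * wprim g t <= y) -> Tub u b g x <= y.
Proof.
move=> x0 ub; apply: ge_ereal_sup => _ [t xt <-].
rewrite u_over_BE; last exact: cy_pos xt.
by apply: ub; move: xt; rewrite /= in_itv/= andbT.
Qed.

Lemma Tub_ge0 g x : (0 < x)%R -> decreasing_nneg g -> 0 <= Tub u b g x.
Proof.
move=> x0 dg; apply: le_trans (Tub_ubound g x0 (lexx x)).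
by rewrite mule_ge0 ?wprim_ge0// lee_fin u_over_B_ge0.
Qed.

Lemma Tub_decreasing g : decreasing_nneg g -> decreasing_nneg (Tub u b g).
Proof.
move=> dg; split => [x x0|x y x0 xy]; first exact: Tub_ge0.
apply: Tub_le_ub => [|t yt]; first exact: lt_le_trans xy.
by apply: Tub_ubound => //; exact: le_trans yt.
Qed.

Lemma le_Tub g h x : (0 < x)%R -> decreasing_nneg g -> decreasing_nneg h ->
  (forall y, (0 < y)%R -> g y <= h y) -> Tub u b g x <= Tub u b h x.
Proof.
move=> x0 dg dh gh; apply: Tub_le_ub => // t xt.
apply: le_trans (Tub_ubound h x0 xt).
by rewrite lee_wpmul2l ?le_wprim// lee_fin u_over_B_ge0// (lt_le_trans x0).
Qed.

Lemma TubD_le g h x : (0 < x)%R -> decreasing_nneg g -> decreasing_nneg h ->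
  Tub u b (fun y => g y + h y) x <= Tub u b g x + Tub u b h x.
Proof.
move=> x0 dg dh; apply: Tub_le_ub => // t xt.
by rewrite wprimD// ge0_muleDr ?wprim_ge0// leeD// Tub_ubound.
Qed.

Lemma TubZ_le k g x : (0 < x)%R -> (0 <= k)%R -> decreasing_nneg g ->
  Tub u b (fun y => k%:E * g y) x <= k%:E * Tub u b g x.
Proof.
move=> x0 k0 dg; apply: Tub_le_ub => // t xt.
by rewrite wprimZ// muleCA lee_wpmul2l// Tub_ubound.
Qed.

(** A supremum over [n] commutes with the supremum defining [T], and with the
    inner integral by monotone convergence. *)
Lemma Tub_sup g (g_ : nat -> R -> \bar R) x : (0 < x)%R ->
  decreasing_nneg g -> (forall n, decreasing_nneg (g_ n)) ->
  (forall x, (0 < x)%R -> {homo g_ ^~ x : n p / (n <= p)%N >-> n <= p}) ->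
  (forall x, (0 < x)%R -> g x <= ereal_sup (range (g_ ^~ x))) ->
  Tub u b g x <= ereal_sup (range (fun n => Tub u b (g_ n) x)).
Proof.
move=> x0 dg dg_ nd le_sup; apply: Tub_le_ub => // t xt.
have t0 : (0 < t)%R by exact: lt_le_trans xt.
rewrite muleC.
have := @ereal_sup_mulr _ _ 0%N _ _ (u_over_B_ge0 t0) (wprim_ge0 t dg)
  (wprim_sup t dg dg_ nd le_sup).
move=> /le_trans; apply; apply: ge_ereal_sup => _ [n _ <-].
apply: le_trans (ereal_sup_ubound _); last by exists n.
by rewrite muleC; exact: Tub_ubound.
Qed.

End averaging.
End operators.

(** * Dyadic layers *)

Section dyadic.
Context {R : realType}.
Implicit Types (r y : \bar R) (d : R).

Definition level_indic d y : \bar R := if d%:E < y then 1 else 0.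

Lemma level_indic_ge0 d y : 0 <= level_indic d y.
Proof. by rewrite /level_indic; case: ifP. Qed.

Lemma le_level_indic d (y z : \bar R) : y <= z -> level_indic d y <= level_indic d z.
Proof.
move=> yz; rewrite /level_indic; case: ifPn => [dy|_];
  first by rewrite (lt_le_trans dy).
by case: ifP.
Qed.

Lemma level_indicM_le d y : 0 <= y -> d%:E * level_indic d y <= y.
Proof.
by move=> y0; rewrite /level_indic; case: ifPn => [dy|_]; rewrite ?mule1 ?mule0// ltW.
Qed.

(** Layers of [y] at the heights [d, 2 d, 4 d, ...]: the height [2^k d] is
    counted when [y] exceeds it.  Doubling heights make the sum a geometric
    series, hence comparable with its last term. *)
Definition dyadic_sum (n : nat) d y : \bar R :=
  \sum_(k < n) (2 ^+ k * d)%:E * level_indic (2 ^+ k * d) y.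

Lemma dyadic_sumS n d y :
  dyadic_sum n.+1 d y =
  dyadic_sum n d y + (2 ^+ n * d)%:E * level_indic (2 ^+ n * d) y.
Proof. by rewrite /dyadic_sum big_ord_recr. Qed.

Lemma le_dyadic_sum n d y z : (0 <= d)%R -> y <= z ->
  dyadic_sum n d y <= dyadic_sum n d z.
Proof.
move=> d0 yz; apply: lee_sum => k _.
by rewrite lee_wpmul2l ?le_level_indic// lee_fin mulr_ge0.
Qed.

Lemma dyadic_sum_le_top n d y : (0 <= d)%R -> dyadic_sum n d y <= (2 ^+ n * d)%:E.
Proof.
move=> d0; elim: n => [|n IH].
  by rewrite /dyadic_sum big_ord0 lee_fin mulr_ge0.
have -> : (2 ^+ n.+1 * d = 2 ^+ n * d + 2 ^+ n * d)%R by rewrite exprS; ring.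
rewrite dyadic_sumS EFinD leeD//.
rewrite -[leRHS]mule1 lee_wpmul2l ?lee_fin ?mulr_ge0//.
by rewrite /level_indic; case: ifP.
Qed.

(** The sum of the layers below the last height [2^n d < y] is at most that
    height, so adding the last layer gives at most twice [y]. *)
Lemma dyadic_sum_le n d y : (0 <= d)%R -> 0 <= y -> dyadic_sum n d y <= 2%:E * y.
Proof.
move=> d0 y0; elim: n => [|n IH].
  by rewrite /dyadic_sum big_ord0 mule_ge0.
rewrite dyadic_sumS /level_indic; case: ifPn => [dy|_]; last by rewrite mule0 adde0.
rewrite mule1; apply: (@le_trans _ _ ((2 ^+ n * d)%:E + (2 ^+ n * d)%:E)).
  by rewrite leeD2r// dyadic_sum_le_top.
have -> : (2 ^+ n * d)%:E + (2 ^+ n * d)%:E = 2%:E * (2 ^+ n * d)%:E.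
  by rewrite -EFinD -EFinM; congr EFin; ring.
by rewrite lee_wpmul2l// ltW.
Qed.

(** If [x] lies between [2^k d] and [2^(k+1) d], then all layers up to [k] are
    counted and sum to [2^(k+1) d - d]. *)
Lemma dyadic_sum_ge n d (x : R) : (0 <= d)%R -> (x <= 2 ^+ n * d)%R ->
  x%:E <= dyadic_sum n d x%:E + d%:E.
Proof.
move=> d0; elim: n => [|n IH] xn.
  by rewrite /dyadic_sum big_ord0 add0e lee_fin (le_trans xn)// expr0 mul1r.
rewrite dyadic_sumS; have [xn'|nx] := leP x (2 ^+ n * d)%R.
  rewrite /level_indic lte_fin ltNge xn' mule0 adde0; exact: IH.
have topE : forall k, (2 ^+ k * d < x)%R ->
    dyadic_sum k.+1 d x%:E + d%:E = (2 ^+ k.+1 * d)%:E.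
  elim => [|k IHk] kx; rewrite dyadic_sumS.
    by rewrite /dyadic_sum big_ord0 /level_indic lte_fin kx mule1 -!EFinD;
      congr EFin; ring.
  rewrite /level_indic lte_fin kx mule1 addeAC IHk.
    by rewrite -EFinD; congr EFin; rewrite !exprS; ring.
  by rewrite (le_lt_trans _ kx)// ler_wpM2r// ler_weXn2l// ler1n.
by rewrite -dyadic_sumS topE.
Qed.

(** Heights from [2^-M] up to [2^(M-1)]; passing from [M] to [M.+1] adds one
    height at each end, so the approximation increases with [M]. *)
Definition dyadic_approx (M : nat) y : \bar R := dyadic_sum (M + M) ((2 ^+ M)^-1) y.

Let dy0 M : (0 <= (2 ^+ M)^-1 :> R)%R.
Proof. by rewrite invr_ge0 exprn_ge0. Qed.

Lemma dyadic_approx_nd y : {homo dyadic_approx ^~ y : n p / (n <= p)%N >-> n <= p}.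
Proof.
apply: homo_leq => [x|x a c|M]; [exact: lexx|exact: le_trans|].
rewrite /dyadic_approx addSn addnS dyadic_sumS.
apply: (@le_trans _ _ (dyadic_sum (M + M).+1 (2 ^+ M.+1)^-1 y)); last first.
  by rewrite leeDl// mule_ge0 ?level_indic_ge0// lee_fin mulr_ge0.
rewrite /dyadic_sum big_ord_recl -[leLHS]add0e leeD//.
  by rewrite mule_ge0 ?level_indic_ge0// lee_fin mulr_ge0.
apply: lee_sum => k _; rewrite /= /bump/= add1n.
have -> : (2 ^+ k.+1 * (2 ^+ M.+1)^-1 = 2 ^+ k * (2 ^+ M)^-1 :> R)%R.
  by rewrite !exprS invfM mulrACA divff ?mul1r// pnatr_eq0.
by [].
Qed.

Lemma le_dyadic_approx_sup y : 0 <= y -> y <= ereal_sup (range (dyadic_approx ^~ y)).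
Proof.
move=> y0; have claim : forall r : R, (0 <= r)%R -> r%:E <= y ->
    r%:E <= ereal_sup (range (dyadic_approx ^~ y)).
  move=> r r0 ry; apply/lee_addgt0Pr => e e0.
  (* With this choice [2^M] exceeds both [r] and [1/e]. *)
  pose M := (Num.truncn (r + e^-1)).+1.
  have M_gt : (r + e^-1 < M%:R)%R by exact: truncnS_gt.
  have M2 : (M%:R <= 2 ^+ M :> R)%R by rewrite -natrX ler_nat ltnW// ltn_expl.
  have r2 : (r <= 2 ^+ M)%R.
    by rewrite (le_trans _ M2)// (le_trans _ (ltW M_gt))// lerDl invr_ge0 ltW.
  have e2 : ((2 ^+ M)^-1 <= e)%R.
    rewrite -[leRHS]invrK lef_pV2 ?posrE ?invr_gt0 ?exprn_gt0//.
    by rewrite (le_trans _ M2)// (le_trans _ (ltW M_gt))// lerDr.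
  have := @dyadic_sum_ge (M + M) _ r (dy0 M).
  rewrite exprD mulfK ?expf_neq0// => /(_ r2) /le_trans; apply.
  apply: leeD; last by rewrite lee_fin.
  apply: le_trans (ereal_sup_ubound _); last by exists M.
  exact: le_dyadic_sum.
case: y y0 claim => [r| |]// r0 claim; first exact: claim.
rewrite leye_eq; apply/eqP/eq_infty => A.
apply: (@le_trans _ _ (Num.max A 0)%:E); first by rewrite lee_fin le_max lexx.
by apply: claim; rewrite ?leey// le_max lexx orbT.
Qed.

Lemma dyadic_approx_le M y : 0 <= y -> dyadic_approx M y <= 2%:E * y.
Proof. exact: dyadic_sum_le. Qed.

End dyadic.

(** * Reduction to characteristic functions *)

Section comparison.
Context {R : realType}.
Local Notation LT := (caratheodory_type (mu_ext (wlength (@idfun R)))).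
Local Notation mu := (@completed_lebesgue_measure R).
Local Notation D := (`]0%R, +oo[%classic : set R).
Implicit Types (g h : R -> \bar R) (k t x y : R).
Variables (m p q : R) (b u v w : R -> R).
Hypotheses (m0 : (0 < m)%R) (m1 : (m <= 1)%R) (p0 : (0 < p)%R) (p1 : (p <= 1)%R)
  (q1 : (1 < q)%R).
Hypotheses (wb : weight b) (wu : weight u) (wv : weight v) (ww : weight w).
Hypothesis B0 : forall t, (0 < t)%R -> 0 < primitive b t /\ primitive b t < +oo.

Let q0 : (0 < q)%R. Proof. exact: lt_trans q1. Qed.
Let mD : measurable (D : set LT). Proof. exact: itv_lebesgue_measurable. Qed.
Let mvD : measurable_fun (D : set LT) v.
Proof. exact: (weight_measurable wv). Qed.
Let mwD : measurable_fun (D : set LT) w.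
Proof. exact: (weight_measurable ww). Qed.
Let v0 x : D x -> (0 <= v x)%R.
Proof. by move=> /pos_itvP; case: wv => _ + _; exact. Qed.
Let w0 x : D x -> (0 <= w x)%R.
Proof. by move=> /pos_itvP; case: ww => _ + _; exact. Qed.

(** The [L^p]-norm over (0, x), as the weighted norm with weight 1. *)
Definition Lp g x : \bar R :=
  @wnorm _ LT R mu `]0%R, x[%classic (fun=> 1%R) p g.

Definition Snorm g : \bar R := @wnorm _ LT R mu D v m (Lp g).

Definition Nnorm g : \bar R := @wnorm _ LT R mu D w q (Tub u b g).

Lemma Snorm_ge0 g : 0 <= Snorm g. Proof. exact: poweR_ge0. Qed.
Lemma Nnorm_ge0 g : 0 <= Nnorm g. Proof. exact: poweR_ge0. Qed.

Let mone x : measurable_fun (`]0%R, x[%classic : set LT) (fun=> 1%R : R).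
Proof. exact: measurable_cst. Qed.

Let moo x : measurable (`]0%R, x[%classic : set LT).
Proof. exact: itv_lebesgue_measurable. Qed.

Lemma Lp_ge0 g x : 0 <= Lp g x. Proof. exact: poweR_ge0. Qed.

Lemma Lp_measurable g : decreasing_nneg g -> nneg_measurable (D : set LT) (Lp g).
Proof.
move=> dg; split; last by move=> x _; exact: Lp_ge0.
apply: nondecreasing_lebesgue_measurable; first exact: interval_is_interval.
move=> x y _ _ xy; apply: le_poweR; first by rewrite invr_ge0 ltW.
  by apply: wint_ge0.
have [mg g0] := nneg_measurable_integrand (w := fun=> 1%R) (@mone y)
  (fun _ _ => ler01) p (decreasing_nneg_measurable_oo y dg).
apply: ge0_subset_integral => //.
move=> z /oo_itvP[z0 zx]; apply/oo_itvP; split=> //; exact: lt_le_trans xy.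
Qed.

Lemma le_Lp g h x : decreasing_nneg g -> decreasing_nneg h ->
  (forall y, (0 < y)%R -> g y <= h y) -> Lp g x <= Lp h x.
Proof.
move=> dg dh gh; apply: le_wnorm => //;
  [exact: ltW|exact: decreasing_nneg_measurable_oo..|].
by move=> y /oo_itvP[y0 _]; exact: gh.
Qed.

Lemma le_Snorm g h : decreasing_nneg g -> decreasing_nneg h ->
  (forall y, (0 < y)%R -> g y <= h y) -> Snorm g <= Snorm h.
Proof.
move=> dg dh gh.
apply: (le_wnorm mu mD mvD v0 (ltW m0) (Lp_measurable dg) (Lp_measurable dh)) => x _.
exact: le_Lp.
Qed.

Lemma SnormZ k g : (0 <= k)%R -> decreasing_nneg g ->
  Snorm (fun x => k%:E * g x) = k%:E * Snorm g.
Proof.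
move=> k0 dg; rewrite /Snorm -wnormZ//; last exact: Lp_measurable.
congr (wnorm _ _ _ _ _); apply/funext => x.
by rewrite /Lp wnormZ//; exact: decreasing_nneg_measurable_oo.
Qed.

(** The reversed Minkowski inequality is used twice: with exponent [p] on
    (0, x), then with exponent [m] and weight [v]. *)
Lemma SnormD_ge g h : decreasing_nneg g -> decreasing_nneg h ->
  Snorm g + Snorm h <= Snorm (fun x => g x + h x).
Proof.
move=> dg dh; apply: (@le_trans _ _
  (@wnorm _ LT R mu D v m (fun x => Lp g x + Lp h x))).
  by apply: wnormD_ge => //; exact: Lp_measurable.
have dgh := decreasing_nnegD dg dh.
have nn : nneg_measurable (D : set LT) (fun x => Lp g x + Lp h x).
  by apply: nneg_measurableD; exact: Lp_measurable.
apply: (le_wnorm mu mD mvD v0 (ltW m0) nn (Lp_measurable dgh)) => x _.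
by apply: wnormD_ge => //; exact: decreasing_nneg_measurable_oo.
Qed.

Lemma Tub_measurable g : decreasing_nneg g ->
  nneg_measurable (D : set LT) (Tub u b g).
Proof.
by move=> dg; apply: decreasing_nneg_measurable_pos; exact: Tub_decreasing.
Qed.

Lemma le_Nnorm g h : decreasing_nneg g -> decreasing_nneg h ->
  (forall y, (0 < y)%R -> g y <= h y) -> Nnorm g <= Nnorm h.
Proof.
move=> dg dh gh.
apply: (le_wnorm mu mD mwD w0 (ltW q0) (Tub_measurable dg) (Tub_measurable dh))
  => x /pos_itvP x0.
exact: le_Tub.
Qed.

Lemma NnormZ_le k g : (0 <= k)%R -> decreasing_nneg g ->
  Nnorm (fun x => k%:E * g x) <= k%:E * Nnorm g.
Proof.
move=> k0 dg; have dkg := decreasing_nnegZ k0 dg.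
rewrite /Nnorm -wnormZ//; last exact: Tub_measurable.
apply: (le_wnorm mu mD mwD w0 (ltW q0) (Tub_measurable dkg)
  (nneg_measurableZ k0 (Tub_measurable dg))).
by move=> x /pos_itvP x0; exact: TubZ_le.
Qed.

Lemma NnormD_le g h : decreasing_nneg g -> decreasing_nneg h ->
  Nnorm (fun x => g x + h x) <= Nnorm g + Nnorm h.
Proof.
move=> dg dh; have dgh := decreasing_nnegD dg dh.
apply: (@le_trans _ _ (@wnorm _ LT R mu D w q (fun x => Tub u b g x + Tub u b h x))).
  have nn : nneg_measurable (D : set LT) (fun x => Tub u b g x + Tub u b h x).
    by apply: nneg_measurableD; exact: Tub_measurable.
  apply: (le_wnorm mu mD mwD w0 (ltW q0) (Tub_measurable dgh) nn) => x /pos_itvP x0.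
  exact: TubD_le.
exact: (wnormD_le mu mD mwD w0 (ltW q1) (Tub_measurable dg) (Tub_measurable dh)).
Qed.

(** Subadditivity on the left and superadditivity on the right transfer the
    bound from the summands to the sum. *)
Lemma Nnorm_sum (C : R) (n : nat) (c : nat -> R) (e : nat -> R -> \bar R) :
  (0 <= C)%R -> (forall i, (0 <= c i)%R) -> (forall i, decreasing_nneg (e i)) ->
  (forall i, Nnorm (e i) <= C%:E * Snorm (e i)) ->
  decreasing_nneg (fun x => \sum_(i < n) (c i)%:E * e i x) /\
  Nnorm (fun x => \sum_(i < n) (c i)%:E * e i x) <=
    C%:E * Snorm (fun x => \sum_(i < n) (c i)%:E * e i x).
Proof.
move=> C0 c0 de NS; elim: n => [|n [IHd IHN]].
  have -> : (fun x => \sum_(i < 0) (c i)%:E * e i x) = (fun x => 0%:E * e 0%N x).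
    by apply/funext => x; rewrite big_ord0 mul0e.
  split; first exact: decreasing_nnegZ.
  by apply: le_trans (NnormZ_le _ _) _; rewrite ?mul0e ?mule_ge0 ?Snorm_ge0.
have dn := decreasing_nnegZ (c0 n) (de n).
have -> : (fun x => \sum_(i < n.+1) (c i)%:E * e i x) =
    (fun x => \sum_(i < n) (c i)%:E * e i x + (c n)%:E * e n x).
  by apply/funext => x; rewrite big_ord_recr.
split; first exact: decreasing_nnegD.
apply: le_trans (NnormD_le IHd dn) _.
have Nn : Nnorm (fun x => (c n)%:E * e n x) <=
    C%:E * Snorm (fun x => (c n)%:E * e n x).
  apply: le_trans (NnormZ_le (c0 n) (de n)) _; rewrite SnormZ// muleCA.
  by apply: lee_wpmul2l; [rewrite lee_fin|exact: NS].
apply: le_trans (leeD IHN Nn) _.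
rewrite -ge0_muleDr; [|exact: Snorm_ge0..].
by apply: lee_wpmul2l; [rewrite lee_fin|exact: SnormD_ge].
Qed.

Definition step t x : \bar R := if (x < t)%R then 1 else 0.

Lemma step_decreasing t : decreasing_nneg (step t).
Proof.
split=> [x _|x y _ xy]; rewrite /step; first by case: ifP.
by case: ifPn => [yt|_]; [rewrite (le_lt_trans xy yt)|case: ifP].
Qed.

Lemma level_indic_decreasing (d : R) g : decreasing_nneg g ->
  decreasing_nneg (fun x => level_indic d (g x)).
Proof.
move=> [g0 gd]; split=> [x _|x y x0 xy]; first exact: level_indic_ge0.
exact/le_level_indic/gd.
Qed.

Hypothesis v_infty :
  \int[mu]_(s in `]1%R, +oo[) (v s * s `^ (m / p))%:E = +oo.

Lemma wint_one r g x : wint (mu : measure LT R) `]0%R, x[%classic (fun=> 1%R) r g =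
  \int[mu]_(s in `]0%R, x[) (g s `^ r).
Proof. by apply: eq_integral => s _; rewrite mule1. Qed.

Lemma Lp_cst1 g x : (0 <= x)%R -> (forall y, (0 < y)%R -> (y < x)%R -> g y = 1) ->
  Lp g x = x%:E `^ p^-1.
Proof.
move=> x0 g1; rewrite /Lp /wnorm wint_one.
rewrite (eq_integral (cst 1)); last first.
  by move=> y; rewrite inE => /oo_itvP[y0 yx]; rewrite g1// poweR1r.
rewrite integral_cst; last exact: itv_lebesgue_measurable.
by rewrite mul1e; congr (_ `^ _); exact: completed_lebesgue_itv0.
Qed.

(** The divergence of [int_1^oo v s^(m/p)] excludes non-increasing functions
    of finite norm that do not tend to 0. *)
Lemma Snorm_one g : (forall x, (0 < x)%R -> g x = 1) -> Snorm g = +oo.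
Proof.
move=> g1; have dg : decreasing_nneg g.
  by split=> [x x0|x y x0 xy]; rewrite !g1// (lt_le_trans x0).
suff : wint (mu : measure LT R) D v m (Lp g) = +oo.
  by rewrite /Snorm /wnorm => ->; rewrite poweRyr// invr_eq0 gt_eqF.
apply/eqP; rewrite -leye_eq -v_infty.
have [mS S0] := nneg_measurable_integrand mvD v0 m (Lp_measurable dg).
have sub1 : `]1%R, +oo[%classic `<=` D.
  by move=> x; rewrite /= !in_itv/= !andbT; exact: lt_trans.
have m1oo : measurable (`]1%R, +oo[%classic : set LT) by exact:
  itv_lebesgue_measurable.
apply: (le_trans _ (@ge0_subset_integral _ LT R mu _ _ m1oo mD _ mS S0 sub1)).
rewrite le_eqVlt; apply/orP; left; apply/eqP; apply: eq_integral => x.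
rewrite inE => /sub1/pos_itvP x0.
rewrite Lp_cst1 ?(ltW x0)//; last by move=> y y0 _; exact: g1.
by rewrite -poweRrM (mulrC p^-1%R) poweR_EFin muleC -EFinM.
Qed.

(** Changing a function at one point does not affect its integrals; hence (0, t)
    and (0, t] need not be distinguished below. *)
Lemma wprim_eq g h t a : decreasing_nneg g -> decreasing_nneg h ->
  (forall x, (0 < x)%R -> x != a -> g x = h x) -> wprim b g t = wprim b h t.
Proof.
move=> dg dh gh; rewrite /wprim.
rewrite (integral_setD1_point a (moo t) (wprim_integrand_measurable wb t dg)).
rewrite (integral_setD1_point a (moo t) (wprim_integrand_measurable wb t dh)).
apply: eq_integral => x; rewrite inE => -[/oo_itvP[x0 _] /eqP xa].
by rewrite gh.
Qed.

(** The set where a non-increasing function exceeds [d] is empty, all of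
    (0, +oo), (0, t) or (0, t].  The second case is excluded by the finiteness
    of the norm. *)
Lemma Nnorm_level_indic (C d : R) g : (0 <= C)%R -> decreasing_nneg g ->
  (forall t, (0 < t)%R -> Nnorm (step t) <= C%:E * Snorm (step t)) ->
  Snorm (fun x => level_indic d (g x)) < +oo ->
  Nnorm (fun x => level_indic d (g x)) <= C%:E * Snorm (fun x => level_indic d (g x)).
Proof.
move=> C0 dg hC Sfin; set e := (fun x => level_indic d (g x)).
have de : decreasing_nneg e by exact: level_indic_decreasing.
pose A := [set x | (0 < x)%R /\ d%:E < g x].
have [[a0 [a00 dga]]|nA] := pselect (exists x, A x); last first.
  (* Without such points [e] equals [0 * e], so homogeneity applies. *)
  apply: (@le_trans _ _ (Nnorm (fun x => 0%:E * e x))).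
    apply: le_Nnorm => //; first exact: decreasing_nnegZ.
    move=> y y0; rewrite mul0e /e /level_indic ifF//; apply: contra_notF nA => dgy.
    by exists y.
  by apply: le_trans (NnormZ_le _ _) _; rewrite ?mul0e ?mule_ge0 ?Snorm_ge0.
have [hub|nub] := pselect (has_ubound A); last first.
  suff S_oo : Snorm e = +oo by rewrite S_oo in Sfin.
  apply: Snorm_one => x x0; rewrite /e /level_indic ifT//.
  have [z [Az xz]] : exists z, A z /\ (x < z)%R.
    apply: contrapT => h; apply: nub; exists x => z Az.
    by rewrite leNgt; apply/negP => xz; apply: h; exists z.
  by case: Az => z0 dgz; apply: lt_le_trans dgz _; apply: dg.2 => //; exact: ltW.
pose t := sup A.
have hsA : has_sup A by split => //; exists a0.
have t0 : (0 < t)%R by exact: lt_le_trans a00 (ub_le_sup hub (conj a00 dga)).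
have estep x : (0 < x)%R -> x != t -> e x = step t x.
  move=> x0 xt; rewrite /e /level_indic /step; have [xlt|] := ltP x t.
    have [z Az xz] := sup_gt (ex_intro _ a0 (conj a00 dga)) xlt.
    rewrite ifT//; case: Az => z0 dgz.
    by apply: lt_le_trans dgz _; apply: dg.2 => //; exact: ltW.
  rewrite le_eqVlt eq_sym (negbTE xt)/= => tx.
  rewrite ifF//; apply/negP => dgx.
  by have := ub_le_sup hub (conj x0 dgx); rewrite leNgt tx.
have TE : Tub u b e = Tub u b (step t).
  apply/funext => x; congr (ereal_sup _); apply: eq_imagel => tau _.
  congr (_ * _); exact: (wprim_eq tau de (step_decreasing t) estep).
have NE : Nnorm e = Nnorm (step t) by rewrite /Nnorm TE.
rewrite NE; apply: le_trans (hC t t0) _.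
apply: lee_wpmul2l; first by rewrite lee_fin.
apply: (le_Snorm (step_decreasing t) de).
move=> y y0; have [->|yt] := eqVneq y t; last by rewrite estep.
by rewrite /step ltxx de.1.
Qed.

(** Each dyadic layer of [g] is bounded by [g], so it has finite norm and
    satisfies the bound; so does the sum of layers, which lies below [2 g], and
    [T] of these sums increases to a function above [T g]. *)
Lemma Nnorm_le_Snorm (C : R) g : (0 <= C)%R -> decreasing_nneg g ->
  (forall t, (0 < t)%R -> Nnorm (step t) <= C%:E * Snorm (step t)) ->
  Snorm g < +oo -> Nnorm g <= (2 * C)%:E * Snorm g.
Proof.
move=> C0 dg hC Sg.
pose h M x := dyadic_approx M (g x).
have lev_le (d : R) : (0 < d)%R -> Nnorm (fun x => level_indic d (g x)) <=
    C%:E * Snorm (fun x => level_indic d (g x)).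
  move=> d0; have d0' := ltW d0; apply: (Nnorm_level_indic C0 dg hC).
  have dl := level_indic_decreasing d dg.
  have le_g : d%:E * Snorm (fun x => level_indic d (g x)) <= Snorm g.
    rewrite -(SnormZ d0' dl); apply: (le_Snorm (decreasing_nnegZ d0' dl) dg).
    by move=> y y0; apply: level_indicM_le; exact: dg.1.
  move: le_g (Snorm_ge0 (fun x => level_indic d (g x))).
  case: (Snorm (fun x => level_indic d (g x))) => [r| |]//; first by rewrite ltry.
  rewrite gt0_muley ?lte_fin// leye_eq => /eqP Sg' _.
  by rewrite Sg' in Sg.
have hM M : decreasing_nneg (h M) /\ Nnorm (h M) <= C%:E * Snorm (h M).
  have cM (i : nat) : (0 < 2 ^+ i * (2 ^+ M)^-1 :> R)%R.
    by rewrite mulr_gt0 ?invr_gt0 ?exprn_gt0.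
  exact: (Nnorm_sum (M + M) C0 (fun i => ltW (cM i))
    (fun i => level_indic_decreasing _ dg) (fun i => lev_le _ (cM i))).
have NhM M : Nnorm (h M) <= (2 * C)%:E * Snorm g.
  apply: le_trans (hM M).2 _; rewrite mulrC EFinM -muleA lee_wpmul2l//.
  rewrite -(SnormZ (ler0n R 2) dg).
  apply: (le_Snorm (hM M).1 (decreasing_nnegZ (ler0n R 2) dg)).
  by move=> y y0; apply: dyadic_approx_le; exact: dg.1.
have CS0 : 0 <= (2 * C)%:E * Snorm g by rewrite mule_ge0 ?Snorm_ge0// lee_fin
  mulr_ge0.
have qV0 : (0 < q^-1)%R by rewrite invr_gt0.
rewrite /Nnorm /wnorm poweR_le_galois ?wint_ge0// invrK.
pose F M x := Tub u b (h M) x `^ q * (w x)%:E.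
apply: (@le_trans _ _ (ereal_sup (range (fun M => \int[mu]_(x in D) F M x))));
  last first.
  apply: ge_ereal_sup => _ [M _ <-]; have := NhM M.
  by rewrite /Nnorm /wnorm poweR_le_galois ?wint_ge0// invrK.
apply: (@integral_le_sup _ LT R mu D mD _ F).
- exact: (nneg_measurable_integrand mwD w0 q (Tub_measurable dg)).
- by move=> M; exact: (nneg_measurable_integrand mwD w0 q (Tub_measurable (hM M).1)).
- move=> x Dx i j ij; have /pos_itvP x0 := Dx.
  apply: lee_wpmul2r; first by rewrite lee_fin; exact: w0.
  apply: le_poweR; [exact: ltW|exact: (Tub_measurable (hM i).1).2|].
  apply: (le_Tub wb wu B0 x0 (hM i).1 (hM j).1).
  by move=> y y0; exact: dyadic_approx_nd.
- move=> x Dx; have /pos_itvP x0 := Dx.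
  apply: (@ereal_sup_mulr _ _ (fun M => Tub u b (h M) x `^ q) 0%N).
  + exact: w0.
  + exact: poweR_ge0.
  have Ts0 : 0 <= ereal_sup (range (fun M => Tub u b (h M) x `^ q)).
    by apply: le_trans (ereal_sup_ubound _); last (by exists 0%N); exact: poweR_ge0.
  rewrite poweR_le_galois//; last exact: Tub_ge0.
  apply: le_trans (Tub_sup wb wu B0 x0 dg (fun M => (hM M).1) _ _) _.
  + by move=> y y0 i j ij; exact: dyadic_approx_nd.
  + by move=> y y0; apply: le_dyadic_approx_sup; exact: dg.1.
  apply: ge_ereal_sup => _ [M _ <-].
  rewrite -poweR_le_galois//; last by apply: Tub_ge0 => //; exact: (hM M).1.
  by apply: ereal_sup_ubound; exists M.
Qed.

End comparison.

(** * Characteristic functions of the intervals (0, t) *)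

Section step_functions.
Context {R : realType}.
Local Notation LT := (caratheodory_type (mu_ext (wlength (@idfun R)))).
Local Notation mu := (@completed_lebesgue_measure R).
Local Notation D := (`]0%R, +oo[%classic : set R).
Implicit Types (g h : R -> \bar R) (k t x y : R).

Lemma ereal_sup_poweR (I : Type) (A : set I) (F : I -> \bar R) (q : R) :
  (0 < q)%R -> A !=set0 -> (forall i, A i -> 0 <= F i) ->
  ereal_sup [set F i `^ q | i in A] = (ereal_sup [set F i | i in A]) `^ q.
Proof.
move=> q0 [i0 Ai0] F0.
have s0 : 0 <= ereal_sup [set F i | i in A].
  by apply: le_trans (ereal_sup_ubound _); [exact: F0 Ai0|exists i0].
have sq0 : 0 <= ereal_sup [set F i `^ q | i in A].
  by apply: le_trans (ereal_sup_ubound _); last (by exists i0); exact: poweR_ge0.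
apply/eqP; rewrite eq_le; apply/andP; split.
  apply: ge_ereal_sup => _ [i Ai <-]; apply: le_poweR; [exact: ltW|exact: F0|].
  by apply: ereal_sup_ubound; exists i.
rewrite poweR_le_galois//; apply: ge_ereal_sup => _ [i Ai <-].
rewrite -poweR_le_galois//; last exact: F0.
by apply: ereal_sup_ubound; exists i.
Qed.

(** [x^s = x * x^(s-1) <= x * (x + y)^(s-1)], and likewise for [y]. *)
Lemma poweR_superadditive (s : R) (x y : \bar R) : (1 <= s)%R ->
  0 <= x -> 0 <= y -> x `^ s + y `^ s <= (x + y) `^ s.
Proof.
move=> s1; have s0 : (0 < s)%R by exact: lt_le_trans s1.
case: x y => [x| |]// [y| |]// x0 y0.
- rewrite -(EFinD x y) !poweR_EFin -EFinD lee_fin.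
  rewrite !lee_fin in x0 y0.
  have s10 : (0 <= s - 1)%R by rewrite subr_ge0.
  rewrite -(mulr_powRB1 x0 s0) -(mulr_powRB1 y0 s0).
  rewrite -(mulr_powRB1 (addr_ge0 x0 y0) s0) mulrDl.
  by rewrite lerD// ler_wpM2l// ge0_ler_powR// ?nnegrE ?addr_ge0// ?lerDl ?lerDr.
- by rewrite addey// !poweRyr ?gt_eqF// leey.
- by rewrite addye// !poweRyr ?gt_eqF// leey.
- by rewrite addye// !poweRyr ?gt_eqF// leey.
Qed.

(** Both sides integrate the same extension by 0 over the line. *)
Lemma integral_oo_trunc (f : R -> \bar R) (t x : R) : (t <= x)%R ->
  (forall y, (t <= y)%R -> f y = 0) ->
  \int[mu]_(s in `]0%R, x[) f s = \int[mu]_(s in `]0%R, t[) f s.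
Proof.
move=> tx f0; rewrite integral_mkcond [RHS]integral_mkcond.
congr (integral _ _ _); apply/funext => y; rewrite /patch !mem_setE !in_itv/=.
have [y0|//] := ltP 0%R y; have [yt|ty] := ltP y t.
  by rewrite (lt_le_trans yt tx).
by rewrite f0//; case: ifP.
Qed.

Variables (m p q : R) (b u v w : R -> R).
Hypotheses (m0 : (0 < m)%R) (p0 : (0 < p)%R) (q1 : (1 < q)%R).
Hypotheses (wb : weight b) (wu : weight u) (wv : weight v) (ww : weight w).
Hypothesis B0 : forall t, (0 < t)%R -> 0 < primitive b t /\ primitive b t < +oo.

Let q0 : (0 < q)%R. Proof. exact: lt_trans q1. Qed.
Let mD : measurable (D : set LT). Proof. exact: itv_lebesgue_measurable. Qed.
Let v0 x : D x -> (0 <= v x)%R.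
Proof. by move=> /pos_itvP; case: wv => _ + _; exact. Qed.
Let w0 x : D x -> (0 <= w x)%R.
Proof. by move=> /pos_itvP; case: ww => _ + _; exact. Qed.
Let mvD : measurable_fun (D : set LT) v.
Proof. exact: (weight_measurable wv). Qed.
Let mwD : measurable_fun (D : set LT) w.
Proof. exact: (weight_measurable ww). Qed.

Let m_oo t : measurable (`]0%R, t[%classic : set LT).
Proof. exact: itv_lebesgue_measurable. Qed.

Let m_cy t : measurable (`]t, +oo[%classic : set LT).
Proof. exact: itv_lebesgue_measurable. Qed.

Lemma Lp_step t x : (0 < t)%R -> (0 < x)%R ->
  Lp p (step t) x = (Num.min x t)%:E `^ p^-1.
Proof.
move=> t0 x0; have [xt|tx] := leP x t.
  rewrite Lp_cst1 ?ltW// => y _ yx.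
  by rewrite /step (lt_le_trans yx xt).
rewrite -(@Lp_cst1 _ p (step t) t (ltW t0)); last by move=> y _ yt; rewrite /step yt.
rewrite /Lp /wnorm !wint_one (integral_oo_trunc (ltW tx))// => y ty.
rewrite (_ : step t y = 0) ?poweR0r ?gt_eqF//.
by rewrite /step ltNge ty.
Qed.

Lemma wprim_step t x : (0 < t)%R -> wprim b (step t) x = primitive b (Num.min x t).
Proof.
move=> t0; rewrite /primitive; have [xt|tx] := leP x t.
  apply: eq_integral => y; rewrite inE => /oo_itvP[_ yx].
  by rewrite /step (lt_le_trans yx xt) mul1e.
rewrite /wprim (integral_oo_trunc (ltW tx)) => [|y ty].
  by apply: eq_integral => y; rewrite inE => /oo_itvP[_ yt]; rewrite /step yt mul1e.
by rewrite /step ltNge ty/= mul0e.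
Qed.

Lemma pos_setD1 t : (0 < t)%R -> D `\ t = `]0%R, t[ `|` `]t, +oo[.
Proof.
move=> t0; apply/seteqP; split => [x [/pos_itvP x0 /eqP xt]|x [/oo_itvP[x0 xt]|]].
- have [xlt|xgt|xE] := ltgtP x t.
  + by left; apply/oo_itvP.
  + by right; rewrite /= in_itv/= xgt.
  + by rewrite xE eqxx in xt.
- by split; [apply/pos_itvP|move=> /= xE; rewrite xE ltxx in xt].
- rewrite /= !in_itv/= !andbT => tx; split; first exact: lt_trans tx.
  by move=> xE; rewrite xE ltxx in tx.
Qed.

Lemma integral_split_at (F : R -> \bar R) t : (0 < t)%R ->
  nneg_measurable (D : set LT) F ->
  \int[mu]_(x in D) F x =
  \int[mu]_(x in `]0%R, t[) F x + \int[mu]_(x in `]t, +oo[) F x.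
Proof.
move=> t0 nF; rewrite (integral_setD1_point t mD nF) pos_setD1//.
have sD : `]0%R, t[ `|` `]t, +oo[ `<=` D.
  by rewrite -pos_setD1//; exact: subDsetl.
have m1 : measurable (`]0%R, t[%classic : set LT) by exact: itv_lebesgue_measurable.
have m2 : measurable (`]t, +oo[%classic : set LT) by exact: itv_lebesgue_measurable.
apply: (@ge0_integral_setU _ LT R mu _ _ m1 m2).
- apply: measurable_funS nF.1 => //.
- by move=> x /sD; exact: nF.2.
- apply/eqP/seteqP; split => // x [/oo_itvP[_ xt]].
  by rewrite /= in_itv/= andbT => /(lt_trans xt); rewrite ltxx.
Qed.

Lemma cy_sub_pos t : (0 < t)%R -> `]t, +oo[%classic `<=` D.
Proof. by move=> t0 x; rewrite /= !in_itv/= !andbT; exact: lt_trans. Qed.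

Lemma Snorm_step t : (0 < t)%R -> Snorm m p v (step t) = v1 m p v t `^ m^-1.
Proof.
move=> t0; rewrite /Snorm /wnorm; congr (_ `^ _).
have nL := nneg_measurable_integrand mvD v0 m (Lp_measurable p0 (step_decreasing t)).
rewrite /wint (integral_split_at t0 nL) /v1; congr (_ + _).
  apply: eq_integral => x; rewrite inE => /oo_itvP[x0 xt].
  rewrite Lp_step// min_l ?ltW//.
  by rewrite -poweRrM (mulrC p^-1%R) poweR_EFin muleC -EFinM.
have tm0 : (0 <= t `^ (m / p))%R by exact: powR_ge0.
have mv' : measurable_fun (`]t, +oo[%classic : set LT) (EFin \o v).
  exact/measurable_EFinP/(weight_measurable wv (cy_sub_pos t0) (m_cy t)).
have v'0 x : `]t, +oo[%classic x -> 0 <= (EFin \o v) x.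
  by move=> /(cy_sub_pos t0) Dx; rewrite lee_fin v0.
rewrite -(@ge0_integralZl_EFin _ LT R mu _ (m_cy t) _ v'0 mv' _ tm0).
apply: eq_integral => x; rewrite inE => tx.
have x0 : (0 < x)%R by apply/pos_itvP/(cy_sub_pos t0).
rewrite Lp_step// min_r; last by rewrite ltW//; move: tx; rewrite /= in_itv/= andbT.
by rewrite -poweRrM (mulrC p^-1%R) poweR_EFin.
Qed.

Definition sup_u_over_B x : \bar R :=
  ereal_sup [set (u tau)%:E / primitive b tau | tau in `[x, +oo[%classic].

Definition sup_u t x : \bar R := ereal_sup [set (u tau)%:E | tau in `[x, t]%classic].

Lemma cy_itvP x t : `[x, +oo[%classic t <-> (x <= t)%R.
Proof. by rewrite /= in_itv/= andbT. Qed.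

Lemma cc_itvP x t y : `[x, t]%classic y <-> (x <= y)%R /\ (y <= t)%R.
Proof. by rewrite /= in_itv/=; split => [/andP[]|[-> ->]]. Qed.

Lemma u_over_primitive_ge0 t : (0 < t)%R -> 0 <= (u t)%:E / primitive b t.
Proof. by move=> t0; rewrite (u_over_BE u B0)// lee_fin (u_over_B_ge0 wu B0). Qed.

Lemma sup_u_over_B_ge0 x : (0 < x)%R -> 0 <= sup_u_over_B x.
Proof.
move=> x0; apply: le_trans (u_over_primitive_ge0 x0) (ereal_sup_ubound _).
by exists x => //; apply/cy_itvP.
Qed.

Lemma sup_u_over_B_decreasing : decreasing_nneg sup_u_over_B.
Proof.
split => [x|x y x0 xy]; first exact: sup_u_over_B_ge0.
apply: ge_ereal_sup => _ [t /cy_itvP yt <-]; apply: ereal_sup_ubound.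
by exists t => //; apply/cy_itvP; exact: le_trans yt.
Qed.

Lemma u_ge0 x : (0 < x)%R -> (0 <= u x)%R.
Proof. by case: wu => _ + _; exact. Qed.

Lemma sup_u_measurable t : nneg_measurable (`]0%R, t[%classic : set LT) (sup_u t).
Proof.
split.
  apply: nonincreasing_lebesgue_measurable; first exact: interval_is_interval.
  move=> x y _ _ xy; apply: ge_ereal_sup => _ [z /cc_itvP[yz zt] <-].
  by apply: ereal_sup_ubound; exists z => //; apply/cc_itvP; split=> //;
    exact: le_trans yz.
move=> x /oo_itvP[x0 xt]; apply: (@le_trans _ _ (u x)%:E);
  first by rewrite lee_fin u_ge0.
by apply: ereal_sup_ubound; exists x => //; apply/cc_itvP; rewrite lexx ltW.
Qed.

Lemma u_over_B_wprim_step_le t tau : (0 < tau)%R -> (tau <= t)%R ->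
  (u_over_B u b tau)%:E * wprim b (step t) tau = (u tau)%:E.
Proof.
move=> tau0 taut; rewrite wprim_step ?(lt_le_trans tau0)// min_l//.
rewrite -(fineK_primitive B0 tau0) -EFinM /u_over_B divfK//.
by rewrite gt_eqF// (fine_primitive_gt0 B0).
Qed.

Lemma u_over_B_wprim_step_ge t tau : (0 < t)%R -> (t <= tau)%R ->
  (u_over_B u b tau)%:E * wprim b (step t) tau =
  primitive b t * ((u tau)%:E / primitive b tau).
Proof.
move=> t0 ttau; rewrite wprim_step// min_r// (u_over_BE u B0) 1?muleC//.
exact: lt_le_trans ttau.
Qed.

Lemma primitive_ge0 t : (0 < t)%R -> 0 <= primitive b t.
Proof. by move=> t0; rewrite ltW// (B0 t0).1. Qed.

Lemma sup_u_le_Tub t x : (0 < x)%R -> (x < t)%R -> sup_u t x <= Tub u b (step t) x.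
Proof.
move=> x0 xt; apply: ge_ereal_sup => _ [tau /cc_itvP[xtau taut] <-].
rewrite -(@u_over_B_wprim_step_le t tau (lt_le_trans x0 xtau) taut).
exact: (Tub_ubound u B0).
Qed.

Lemma sup_u_over_B_le_Tub t x y : (0 < t)%R -> (0 < x)%R ->
  (t <= y)%R -> (x <= y)%R ->
  primitive b t * sup_u_over_B y <= Tub u b (step t) x.
Proof.
move=> t0 x0 ty xy; rewrite -(fineK_primitive B0 t0) -ereal_sup_pZl
  ?(fine_primitive_gt0 B0)//.
apply: ge_ereal_sup => _ [_ [tau /cy_itvP ytau <-] <-].
rewrite (fineK_primitive B0 t0) -u_over_B_wprim_step_ge// ?(le_trans ty)//.
by apply: (Tub_ubound u B0) => //; exact: le_trans ytau.
Qed.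

Lemma Tub_step_low t x : (0 < x)%R -> (x < t)%R ->
  Tub u b (step t) x <= maxe (sup_u t x) (primitive b t * sup_u_over_B t).
Proof.
move=> x0 xt; have t0 := lt_trans x0 xt.
apply: (Tub_le_ub B0 x0) => tau xtau; rewrite le_max.
have [taut|ttau] := leP tau t.
  rewrite u_over_B_wprim_step_le// ?(lt_le_trans x0)//.
  by rewrite ereal_sup_ubound//; exists tau => //; apply/cc_itvP.
rewrite u_over_B_wprim_step_ge ?(ltW ttau)//; apply/orP; right.
apply: lee_wpmul2l; first exact: primitive_ge0.
by apply: ereal_sup_ubound; exists tau => //; apply/cy_itvP/ltW.
Qed.

Lemma Tub_step_high t x : (0 < t)%R -> (t <= x)%R ->
  Tub u b (step t) x <= primitive b t * sup_u_over_B x.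
Proof.
move=> t0 tx; have x0 := lt_le_trans t0 tx.
apply: (Tub_le_ub B0 x0) => tau xtau.
rewrite u_over_B_wprim_step_ge ?(le_trans tx)//.
apply: lee_wpmul2l; first exact: primitive_ge0.
by apply: ereal_sup_ubound; exists tau => //; apply/cy_itvP.
Qed.

(** The integrals in the three suprema of the characterization: over (0, t) for
    the first two, over (t, +oo) for the last. *)
Definition head_sup_integral t : \bar R := \int[mu]_(x in `]0%R, t[)
  (ereal_sup [set (u tau `^ q)%:E | tau in `[x, t]%classic] * (w x)%:E).

Definition head_integral t : \bar R := \int[mu]_(x in `]0%R, t[) (w x)%:E.

Definition tail_sup_integral t : \bar R := \int[mu]_(x in `]t, +oo[)
  (ereal_sup [set ((u tau)%:E / primitive b tau) `^ q
             | tau in `[x, +oo[%classic] * (w x)%:E).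

Let mw_oo t : measurable_fun (`]0%R, t[%classic : set LT) w.
Proof. by apply: (weight_measurable ww) => //; exact: oo_sub_pos. Qed.

Let w0_oo t x : `]0%R, t[%classic x -> (0 <= w x)%R.
Proof. by move/oo_sub_pos; exact: w0. Qed.

Let mw_cy t : (0 < t)%R -> measurable_fun (`]t, +oo[%classic : set LT) w.
Proof. by move=> t0; apply: (weight_measurable ww) => //; exact: cy_sub_pos. Qed.

Let w0_cy t : (0 < t)%R -> forall x, `]t, +oo[%classic x -> (0 <= w x)%R.
Proof. by move=> t0 x /(cy_sub_pos t0); exact: w0. Qed.

Lemma sup_u_over_B_measurable_cy t : (0 < t)%R ->
  nneg_measurable (`]t, +oo[%classic : set LT) sup_u_over_B.
Proof.
move=> t0; apply: decreasing_nneg_measurable sup_u_over_B_decreasing.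
  exact: interval_is_interval.
exact: cy_sub_pos.
Qed.

Lemma head_sup_integralE t : head_sup_integral t =
  wint (mu : measure LT R) `]0%R, t[%classic w q (sup_u t).
Proof.
apply: eq_integral => x; rewrite inE => /oo_itvP[x0 xt]; congr (_ * _).
rewrite -ereal_sup_poweR//.
- by exists x; apply/cc_itvP; rewrite lexx ltW.
- by move=> y /cc_itvP[xy _]; rewrite lee_fin u_ge0// (lt_le_trans x0).
Qed.

Lemma head_integralE t (c : \bar R) : 0 <= c ->
  wint (mu : measure LT R) `]0%R, t[%classic w q (fun=> c) = c `^ q * head_integral t.
Proof.
move=> c0; have mw' : measurable_fun (`]0%R, t[%classic : set LT) (EFin \o w).
  exact/measurable_EFinP/mw_oo.
apply: (@ge0_integralZl _ LT R mu _ (m_oo t) _ mw').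
  by move=> x /w0_oo wx; rewrite lee_fin.
exact: poweR_ge0.
Qed.

Lemma tail_sup_integralE t : (0 < t)%R ->
  tail_sup_integral t = wint (mu : measure LT R) `]t, +oo[%classic w q sup_u_over_B.
Proof.
move=> t0; apply: eq_integral => x; rewrite inE => /(cy_sub_pos t0)/pos_itvP x0.
congr (_ * _); rewrite ereal_sup_poweR//; first by exists x; apply/cy_itvP.
by move=> y /cy_itvP xy; apply: u_over_primitive_ge0; exact: lt_le_trans xy.
Qed.

Lemma head_integral_ge0 t : 0 <= head_integral t.
Proof. by apply: integral_ge0 => x /w0_oo; rewrite lee_fin. Qed.

Let nT t : nneg_measurable (D : set LT) (Tub u b (step t)).
Proof. exact: (Tub_measurable wb wu B0 (step_decreasing t)). Qed.

Let nTw t := nneg_measurable_integrand mwD w0 q (nT t).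

Let wint_sub (A : set R) t : measurable (A : set LT) -> A `<=` D ->
  wint (mu : measure LT R) A w q (Tub u b (step t)) `^ q^-1 <= Nnorm q b u w (step t).
Proof.
move=> mA AD; apply: le_poweR; first by rewrite invr_ge0 ltW.
  by apply: wint_ge0 => x /AD; exact: w0.
exact: (@ge0_subset_integral _ LT R mu _ _ mA mD _ (nTw t).1 (nTw t).2 AD).
Qed.

Let nT_oo t s : nneg_measurable (`]0%R, s[%classic : set LT) (Tub u b (step t)).
Proof.
apply: decreasing_nneg_measurable_oo; apply: (Tub_decreasing wb wu B0).
exact: step_decreasing.
Qed.

Let nT_cy t s : (0 < s)%R ->
  nneg_measurable (`]s, +oo[%classic : set LT) (Tub u b (step t)).
Proof.
move=> s0; apply: decreasing_nneg_measurable.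
- exact: interval_is_interval.
- exact: cy_sub_pos.
- by apply: (Tub_decreasing wb wu B0); exact: step_decreasing.
Qed.

Lemma head_sup_le_Nnorm t : (0 < t)%R ->
  head_sup_integral t `^ q^-1 <= Nnorm q b u w (step t).
Proof.
move=> t0; apply: le_trans (wint_sub t (m_oo t) (@oo_sub_pos _ t)).
rewrite head_sup_integralE; apply: (le_wnorm mu (m_oo t) (@mw_oo t) (@w0_oo t)
  (ltW q0)).
- exact: sup_u_measurable.
- exact: nT_oo.
- by move=> x /oo_itvP[x0 xt]; exact: sup_u_le_Tub.
Qed.

Lemma head_le_Nnorm t : (0 < t)%R ->
  primitive b t * sup_u_over_B t * head_integral t `^ q^-1 <= Nnorm q b u w (step t).
Proof.
move=> t0; apply: le_trans (wint_sub t (m_oo t) (@oo_sub_pos _ t)).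
set c := primitive b t * sup_u_over_B t.
have c0 : 0 <= c by rewrite mule_ge0 ?primitive_ge0 ?sup_u_over_B_ge0.
have -> : c * head_integral t `^ q^-1 = (c `^ q * head_integral t) `^ q^-1.
  by rewrite poweRM ?poweR_ge0 ?head_integral_ge0// poweRK// gt_eqF.
rewrite -head_integralE//; apply: (le_wnorm mu (m_oo t) (@mw_oo t) (@w0_oo t)
  (ltW q0)).
- by split => //; exact: measurable_cst.
- exact: nT_oo.
- by move=> x /oo_itvP[x0 xt]; apply: sup_u_over_B_le_Tub => //; exact: ltW.
Qed.

Lemma tail_sup_le_Nnorm t : (0 < t)%R ->
  primitive b t * tail_sup_integral t `^ q^-1 <= Nnorm q b u w (step t).
Proof.
move=> t0; apply: le_trans (wint_sub t (m_cy t) (cy_sub_pos t0)).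
have B'0 := ltW (fine_primitive_gt0 B0 t0).
rewrite tail_sup_integralE// -(fineK_primitive B0 t0).
rewrite -(wnormZ mu (m_cy t) (mw_cy t0) (w0_cy t0) q0 B'0
  (sup_u_over_B_measurable_cy t0)).
apply: (le_wnorm mu (m_cy t) (mw_cy t0) (w0_cy t0) (ltW q0)).
- by apply: nneg_measurableZ => //; exact: sup_u_over_B_measurable_cy.
- exact: nT_cy.
- move=> x tx; have x0 : (0 < x)%R by apply/pos_itvP/(cy_sub_pos t0).
  rewrite (fineK_primitive B0 t0); apply: sup_u_over_B_le_Tub => //.
  by rewrite ltW//; move: tx; rewrite /= in_itv/= andbT.
Qed.

(** On (0, t) the [q]-th power of the maximum of two terms is at most the sum
    of their [q]-th powers, and the [q]-th root of a sum of three terms is at most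
    the sum of the roots. *)
Lemma Nnorm_step_le t : (0 < t)%R -> Nnorm q b u w (step t) <=
  head_sup_integral t `^ q^-1 +
  primitive b t * sup_u_over_B t * head_integral t `^ q^-1 +
  primitive b t * tail_sup_integral t `^ q^-1.
Proof.
move=> t0; set c := primitive b t * sup_u_over_B t.
have c0 : 0 <= c by rewrite mule_ge0 ?primitive_ge0 ?sup_u_over_B_ge0.
have B'0 := ltW (fine_primitive_gt0 B0 t0).
have I10 : 0 <= head_sup_integral t by rewrite head_sup_integralE;
  apply: wint_ge0; exact: w0_oo.
have I30 : 0 <= tail_sup_integral t by rewrite tail_sup_integralE//;
  apply: wint_ge0; exact: w0_cy.
have a0 : 0 <= head_sup_integral t `^ q^-1 by exact: poweR_ge0.
have d0 : 0 <= c * head_integral t `^ q^-1 by rewrite mule_ge0 ?poweR_ge0.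
have e0 : 0 <= primitive b t * tail_sup_integral t `^ q^-1 by rewrite mule_ge0
  ?poweR_ge0 ?primitive_ge0.
rewrite /Nnorm /wnorm poweR_le_galois ?invr_gt0//; last 2 first.
- exact: wint_ge0.
- by rewrite !adde_ge0.
rewrite invrK.
apply: le_trans (poweR_superadditive (ltW q1) (adde_ge0 a0 d0) e0).
apply: (@le_trans _ _
   ((head_sup_integral t `^ q^-1) `^ q + (c * head_integral t `^ q^-1) `^ q +
    (primitive b t * tail_sup_integral t `^ q^-1) `^ q)); last first.
  by rewrite leeD2r// poweR_superadditive// ltW.
have qn0 : q != 0%R by rewrite gt_eqF.
have B'e0 := primitive_ge0 t0.
rewrite (poweRVK qn0 I10) (poweRM _ c0 (poweR_ge0 (head_integral t) _)).
rewrite (poweRM _ B'e0 (poweR_ge0 (tail_sup_integral t) _)).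
rewrite (poweRVK qn0 (head_integral_ge0 t)) (poweRVK qn0 I30).
have ncst : nneg_measurable (`]0%R, t[%classic : set LT) (fun=> c).
  by split => //; exact: measurable_cst.
have n1 := nneg_measurable_integrand (@mw_oo t) (@w0_oo t) q (sup_u_measurable t).
have n2 := nneg_measurable_integrand (@mw_oo t) (@w0_oo t) q ncst.
have n12 := nneg_measurableD n1 n2.
have nTo := nneg_measurable_integrand (@mw_oo t) (@w0_oo t) q (nT_oo t t).
have n3 := nneg_measurableZ (powR_ge0 (fine (primitive b t)) q)
  (nneg_measurable_integrand (mw_cy t0) (w0_cy t0) q (sup_u_over_B_measurable_cy t0)).
have n3' := nneg_measurable_integrand (mw_cy t0) (w0_cy t0) q
  (sup_u_over_B_measurable_cy t0).
have nTc := nneg_measurable_integrand (mw_cy t0) (w0_cy t0) q (nT_cy t t0).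
have low : \int[mu]_(x in `]0%R, t[) (Tub u b (step t) x `^ q * (w x)%:E) <=
    head_sup_integral t + c `^ q * head_integral t.
  rewrite head_sup_integralE -(head_integralE t c0) /wint.
  rewrite -(@ge0_integralD _ LT R mu _ (m_oo t) _ _ n1.2 n1.1 n2.2 n2.1).
  apply: (@ge0_le_integral _ LT R mu _ (m_oo t) _ _ nTo.2 nTo.1 n12.1) => x Ax.
  have [x0 xt] := (oo_itvP x t).1 Ax.
  have wx0 : 0 <= (w x)%:E by rewrite lee_fin; exact: w0_oo Ax.
  have U0 := (sup_u_measurable t).2 x Ax.
  rewrite -ge0_muleDl ?poweR_ge0//; apply: lee_wpmul2r => //.
  apply: (@le_trans _ _ (maxe (sup_u t x) c `^ q)).
    apply: le_poweR; [exact: ltW|exact: (nT_oo t t).2|exact: Tub_step_low].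
  by rewrite maxEle; case: ifP => _; rewrite ?leeDl ?leeDr ?poweR_ge0.
have high : \int[mu]_(x in `]t, +oo[) (Tub u b (step t) x `^ q * (w x)%:E) <=
    primitive b t `^ q * tail_sup_integral t.
  rewrite tail_sup_integralE// -[primitive b t in X in _ <= X](fineK_primitive B0 t0).
  rewrite poweR_EFin /wint.
  rewrite -(@ge0_integralZl_EFin _ LT R mu _ (m_cy t) _ n3'.2 n3'.1 _ (powR_ge0 _ _)).
  apply: (@ge0_le_integral _ LT R mu _ (m_cy t) _ _ nTc.2 nTc.1 n3.1) => x Ax.
  have wx0 : 0 <= (w x)%:E by rewrite lee_fin; exact: w0_cy Ax.
  have x0 : (0 < x)%R by apply/pos_itvP/(cy_sub_pos t0).
  rewrite muleA; apply: lee_wpmul2r => //.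
  rewrite -poweR_EFin (fineK_primitive B0 t0) -(poweRM _ B'e0 (sup_u_over_B_ge0 x0)).
  apply: le_poweR; [exact: ltW|exact: (nT_cy t t0).2|].
  by apply: Tub_step_high => //; rewrite ltW//; move: Ax; rewrite /= in_itv/= andbT.
by rewrite /wint (integral_split_at t0 (nTw t)); exact: (leeD low high).
Qed.

End step_functions.

(** * Boxes in Euclidean space *)

Section box_cover.
Context {R : realType}.
Local Notation leb := (@lebesgue_measure R).
Implicit Types (a c x : nat -> R).

(** Boxes and volumes in terms of coordinate sequences indexed by all natural
    numbers, of which the first [N] count: the induction on the dimension
    then just splits off the coordinate [N]. *)
Definition coord_box N a c x : Prop := forall i, (i < N)%N -> (a i < x i <= c i)%R.
Definition coord_volume N a c : R := (\prod_(i < N) Num.max (c i - a i) 0)%R.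

Lemma coord_volume_ge0 N a c : (0 <= coord_volume N a c)%R.
Proof. by apply: prodr_ge0 => i _; rewrite le_max lexx orbT. Qed.

Lemma coord_volumeS N a c : coord_volume N.+1 a c =
  (coord_volume N a c * Num.max (c N - a N) 0)%R.
Proof. by rewrite /coord_volume big_ord_recr. Qed.

Lemma lebesgue_itvoc (a c : R) : leb `]a, c]%classic = (Num.max (c - a) 0)%:E.
Proof.
rewrite lebesgue_measure_itv/= lte_fin; case: ltP => ac.
  by rewrite max_l// subr_ge0 ltW.
by rewrite max_r// subr_le0.
Qed.

(** Tonelli's argument, one coordinate at a time.  For fixed last coordinate [z]
    the slices of the covering boxes that meet the hyperplane cover the slice of
    the box; integrating the resulting inequality in [z] gives the claim.  The
    predicate [J] selects the boxes that take part: an empty slice could not be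
    encoded by a box in dimension 0. *)
Lemma coord_volume_le_cover N a c (J : nat -> bool)
    (F : nat -> (nat -> R) * (nat -> R)) :
  (forall x, coord_box N a c x -> exists k, J k /\ coord_box N (F k).1 (F k).2 x) ->
  (coord_volume N a c)%:E <=
    \sum_(0 <= k <oo) ((J k)%:R * coord_volume N (F k).1 (F k).2)%:E.
Proof.
elim: N J a c => [|N IH] J a c cov.
  have [k [Jk _]] : exists k, J k /\ coord_box 0 (F k).1 (F k).2 a by exact: cov.
  rewrite /coord_volume big_ord0.
  under eq_eseriesr do rewrite big_ord0 mulr1.
  rewrite (nneseriesD1 (n := k))//.
  by rewrite Jk leeDl// nneseries_ge0// => i _ _; rewrite lee_fin.
pose I k : set R := `](F k).1 N, (F k).2 N]%classic.
pose v k : R := ((J k)%:R * coord_volume N (F k).1 (F k).2)%R.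
have v0 k : (0 <= v k)%R by rewrite mulr_ge0// coord_volume_ge0.
have mI k : measurable (I k : set (measurableTypeR R)) by exact: measurable_itv.
pose A : set R := `]a N, c N]%classic.
have mA : measurable (A : set (measurableTypeR R)) by exact: measurable_itv.
have slice z : A z -> (coord_volume N a c)%:E <=
    \sum_(0 <= k <oo) ((v k)%:E * (\1_(I k) z)%:E).
  rewrite /A/= in_itv/= => /andP[az zc].
  have cov' x : coord_box N a c x ->
      exists k, J k && (z \in I k) /\ coord_box N (F k).1 (F k).2 x.
    move=> xac; pose y i := if i == N then z else x i.
    have [k [Jk yk]] : exists k, J k /\ coord_box N.+1 (F k).1 (F k).2 y.
      apply: cov => i; rewrite ltnS leq_eqVlt /y.
      case: eqVneq => [-> _|iN /= iltN]; first by rewrite az zc.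
      exact: xac.
    exists k; split.
      rewrite Jk/= inE /I/= in_itv/=.
      by have := yk N (ltnSn N); rewrite /y eqxx.
    by move=> i iN; have := yk i (ltnW iN); rewrite /y (ltn_eqF iN).
  have := IH (fun k => J k && (z \in I k)) a c cov'.
  move=> /le_trans; apply; apply: lee_nneseries => [k _ _|k _].
    by rewrite lee_fin mulr_ge0// coord_volume_ge0.
  rewrite -EFinM lee_fin /v indicE; case: (J k) => /=; rewrite ?mul0r//.
  by rewrite mul1r mulrC.
have mind k : measurable_fun (A : set (measurableTypeR R))
    (fun z => (v k)%:E * (\1_(I k) z)%:E).
  apply: emeasurable_funM; first exact: measurable_cst.
  exact/measurable_EFinP/measurable_indic.
rewrite coord_volumeS EFinM -lebesgue_itvoc -/A.
rewrite -(@integral_cst _ (measurableTypeR R) R leb A mA).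
apply: (@le_trans _ _ (\int[leb]_(z in A)
    \sum_(0 <= k <oo) ((v k)%:E * (\1_(I k) z)%:E))).
  apply: ge0_le_integral => //.
  - by move=> z _; rewrite /= lee_fin coord_volume_ge0.
  - apply: ge0_emeasurable_sum => //.
    by move=> k z _ _; rewrite -EFinM lee_fin mulr_ge0.
rewrite integral_nneseries//; last by move=> k z _; rewrite -EFinM lee_fin mulr_ge0.
apply: lee_nneseries => [k _ _|k _].
  by apply: integral_ge0 => z _; rewrite -EFinM lee_fin mulr_ge0.
rewrite ge0_integralZl_EFin//; last exact/measurable_EFinP/measurable_indic.
rewrite integral_indic// coord_volumeS mulrA [leRHS]EFinM -lebesgue_itvoc.
apply: lee_wpmul2l; first by rewrite lee_fin v0.
by apply: le_measure; rewrite ?inE//; exact: measurableI.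
Qed.

End box_cover.

Section lebesgue_outer_measure.
Context {R : realType} (n' : nat).
Local Notation n := n'.+1.
Implicit Types (a c x : 'rV[R]_n) (A : set 'rV[R]_n).

Lemma box_volume_ge0 a c : (0 <= box_volume a c)%R.
Proof. by apply: prodr_ge0 => i _; rewrite le_max lexx orbT. Qed.

Definition covers (F : nat -> 'rV[R]_n * 'rV[R]_n) A :=
  A `<=` \bigcup_k box (F k).1 (F k).2.

Lemma lebesgue_outer_le (F : nat -> 'rV[R]_n * 'rV[R]_n) A : covers F A ->
  lebesgue_outer A <= \sum_(0 <= k <oo) (box_volume (F k).1 (F k).2)%:E.
Proof. by move=> FA; apply: ereal_inf_lbound; exists F. Qed.

Lemma lebesgue_outer_ge A (y : \bar R) :
  (forall F, covers F A -> y <= \sum_(0 <= k <oo) (box_volume (F k).1 (F k).2)%:E) ->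
  y <= lebesgue_outer A.
Proof. by move=> h; apply: le_ereal_inf_tmp => _ [F FA <-]; exact: h. Qed.

Lemma lebesgue_outer_ge0 A : 0 <= lebesgue_outer A.
Proof.
apply: lebesgue_outer_ge => F _; apply: nneseries_ge0 => k _ _.
by rewrite lee_fin box_volume_ge0.
Qed.

Lemma box_volume00 : box_volume (0%R : 'rV[R]_n) 0%R = 0%R :> R.
Proof. by rewrite /box_volume big_ord_recl !mxE subrr max_l// mul0r. Qed.

Lemma lebesgue_outer_box_le a c : lebesgue_outer (box a c) <= (box_volume a c)%:E.
Proof.
pose F (k : nat) := if k == 0%N then (a, c) else (0%R, 0%R).
apply: le_trans (@lebesgue_outer_le F _ _) _.
  by move=> x xac; exists 0%N.
rewrite (nneseriesD1 (n := 0%N))//; last first.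
  by move=> k _; rewrite lee_fin box_volume_ge0.
rewrite /= eseries0 ?adde0// => k _ /negbTE k0.
by rewrite /F k0/= box_volume00.
Qed.

Lemma lebesgue_outer0 : lebesgue_outer (set0 : set 'rV[R]_n) = 0.
Proof.
apply/eqP; rewrite eq_le lebesgue_outer_ge0 andbT.
have := lebesgue_outer_box_le 0%R 0%R; rewrite box_volume00.
apply: le_trans; apply: lebesgue_outer_ge => F FA.
by apply: lebesgue_outer_le => x.
Qed.

Lemma le_lebesgue_outer :
  {homo (@lebesgue_outer R n) : A B / A `<=` B >-> A <= B}.
Proof.
move=> A B AB; apply: lebesgue_outer_ge => F FB; apply: lebesgue_outer_le.
exact: subset_trans FB.
Qed.

(** Choose for the [k]-th set a cover within [e / 2^(k+1)] of its outer measure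
    and enumerate all the boxes by a bijection from nat to pairs. *)
Lemma lebesgue_outer_sigma_subadditive : sigma_subadditive (@lebesgue_outer R n).
Proof.
move=> A; have [[i ioo]|] := pselect (exists i, lebesgue_outer (A i) = +oo).
  rewrite (eseries_pinfty _ _ ioo) ?leey// => k _.
  by rewrite -ltNye (lt_le_trans _ (lebesgue_outer_ge0 _)).
rewrite -forallNE => Aoo; apply/lee_addgt0Pr => e e0.
rewrite (le_trans _ (epsilon_trick _ _ (ltW e0)))//; last first.
  by move=> k; exact: lebesgue_outer_ge0.
pose vol (F : 'rV[R]_n * 'rV[R]_n) : \bar R := (box_volume F.1 F.2)%:E.
have vol0 F : 0 <= vol F by rewrite lee_fin box_volume_ge0.
pose P k (F : nat -> 'rV[R]_n * 'rV[R]_n) := covers F (A k) /\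
  \sum_(0 <= j <oo) vol (F j) <= lebesgue_outer (A k) + (e / (2 ^ k.+1)%:R)%:E.
have [G PG] : {G : nat -> nat -> 'rV[R]_n * 'rV[R]_n & forall k, P k (G k)}.
  apply: (@choice _ _ P) => k.
  have fA : lebesgue_outer (A k) \is a fin_num.
    by rewrite ge0_fin_numE ?lebesgue_outer_ge0// ltey; apply/eqP; exact: Aoo.
  have ek : (0 < e / (2 ^ k.+1)%:R)%R by rewrite divr_gt0// ltr0n expn_gt0.
  have [_ [F FA <-] Fe] := lb_ereal_inf_adherent ek fA.
  by exists F; split => //; exact: ltW.
have [f fbij] : exists f : nat -> nat * nat, set_bij setT setT f.
  by apply/card_set_bijP/card_esym; exact: card_nat2.
have [_ _ fsurj] := fbij.
apply: (@le_trans _ _ (\sum_(0 <= k <oo) vol (G (f k).1 (f k).2))).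
  apply: lebesgue_outer_le => x [i _ /(PG i).1 [j _ Gij]].
  have [k _ fk] := fsurj (i, j) I.
  by exists k => //; rewrite fk.
rewrite nneseries_esumT//.
rewrite -(@reindex_esum R _ _ setT setT f (fun k => vol (G k.1 k.2)) fbij).
have -> : [set: nat * nat] = [set: nat] `*`` (fun=> [set: nat]).
  by apply/seteqP; split.
rewrite -(@esum_esum R _ _ setT (fun=> setT) (fun i j => vol (G i j)))//.
rewrite -nneseries_esumT; last by move=> k; apply: esum_ge0.
apply: lee_nneseries => [k _ _|k _]; first exact: esum_ge0.
by rewrite -nneseries_esumT//; exact: (PG k).2.
Qed.

HB.instance Definition _ := isOuterMeasure.Build R 'rV[R]_n (@lebesgue_outer R n)
  lebesgue_outer0 lebesgue_outer_ge0 le_lebesgue_outer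
  lebesgue_outer_sigma_subadditive.

Lemma lebesgue_outer_box a c : lebesgue_outer (box a c) = (box_volume a c)%:E.
Proof.
apply/eqP; rewrite eq_le lebesgue_outer_box_le/=.
apply: lebesgue_outer_ge => F FA.
pose nat_of (y : 'rV[R]_n) (i : nat) : R := y ord0 (inord i).
have volE (y z : 'rV[R]_n) : box_volume y z = coord_volume n (nat_of y) (nat_of z).
  by apply: eq_bigr => i _; rewrite /nat_of inord_val.
have := @coord_volume_le_cover R n (nat_of a) (nat_of c) xpredT
  (fun k => (nat_of (F k).1, nat_of (F k).2)).
rewrite volE; under eq_eseriesr do rewrite mul1r/= -volE.
apply=> x xac; pose X : 'rV[R]_n := \row_i x i.
have : box a c X.
  move=> i; rewrite mxE; have := xac i (ltn_ord i).
  by rewrite /nat_of inord_val.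
move=> /FA[k _ Xk]; exists k; split => // i iN.
by have := Xk (inord i); rewrite mxE inordK.
Qed.

Definition set_coord (y : 'rV[R]_n) (i : 'I_n) (z : R) : 'rV[R]_n :=
  \row_j (if j == i then z else y ord0 j).

Lemma box_volumeD1 (i : 'I_n) a c : box_volume a c =
  (Num.max (c ord0 i - a ord0 i) 0 *
   \prod_(j < n | j != i) Num.max (c ord0 j - a ord0 j) 0)%R.
Proof. by rewrite /box_volume (bigD1 i). Qed.

Lemma box_volume_cut a c (i : 'I_n) (z : R) : box_volume a c =
  (box_volume a (set_coord c i (Num.min (c ord0 i) z)) +
   box_volume (set_coord a i (Num.max (a ord0 i) z)) c)%R.
Proof.
rewrite !(box_volumeD1 i) !mxE eqxx.
set P := (\prod_(j < n | j != i) Num.max (c ord0 j - a ord0 j) 0)%R.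
have -> : (\prod_(j < n | j != i)
    Num.max (set_coord c i (Num.min (c ord0 i) z) ord0 j - a ord0 j) 0 = P)%R.
  by apply: eq_bigr => j /negbTE ji; rewrite mxE ji.
have -> : (\prod_(j < n | j != i)
    Num.max (c ord0 j - set_coord a i (Num.max (a ord0 i) z) ord0 j) 0 = P)%R.
  by apply: eq_bigr => j /negbTE ji; rewrite mxE ji.
rewrite -mulrDl; congr (_ * _)%R.
move: (a ord0 i) (c ord0 i) => r s.
rewrite /Num.min /Num.max; do ![case: ifPn]; rewrite -?leNgt; lra.
Qed.

(** A hyperplane cuts each box of a cover in two boxes whose volumes add up. *)
Lemma halfspace_caratheodory (i : 'I_n) (z : R) :
  (@lebesgue_outer R n).-caratheodory [set x : 'rV[R]_n | (x ord0 i <= z)%R].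
Proof.
apply: le_caratheodory_measurable => X; apply: lebesgue_outer_ge => F FX.
under eq_eseriesr => k _ do rewrite (box_volume_cut _ _ i z) EFinD.
rewrite nneseriesD; last 2 first.
- by move=> k _ _; rewrite lee_fin box_volume_ge0.
- by move=> k _ _; rewrite lee_fin box_volume_ge0.
apply: leeD.
  apply: (@lebesgue_outer_le (fun k =>
    ((F k).1, set_coord (F k).2 i (Num.min ((F k).2 ord0 i) z)))).
  move=> x [/FX[k _ xk] /= xz]; exists k => // j /=; rewrite mxE.
  by case: eqVneq => [->|_]; rewrite ?le_min ?xz ?andbT; exact: (xk _).
apply: (@lebesgue_outer_le (fun k =>
  (set_coord (F k).1 i (Num.max ((F k).1 ord0 i) z), (F k).2))).
move=> x [/FX[k _ xk] /= /negP xz]; exists k => // j /=; rewrite mxE.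
case: eqVneq => [->|_]; last exact: (xk _).
by rewrite gt_max (ltNge z) xz andbT; exact: (xk _).
Qed.

Lemma box_caratheodory a c : (@lebesgue_outer R n).-caratheodory (box a c).
Proof.
have h (s : seq 'I_n) : (@lebesgue_outer R n).-caratheodory
    [set x : 'rV[R]_n | forall i, i \in s -> (a ord0 i < x ord0 i <= c ord0 i)%R].
  elim: s => [|i s IH].
    rewrite (_ : [set _ | _] = ~` set0); last first.
      by rewrite setC0; apply/seteqP; split => x _ // i; rewrite in_nil.
    exact/caratheodory_measurable_setC/caratheodory_measurable_set0.
  rewrite (_ : [set _ | _] = ([set x : 'rV[R]_n | (x ord0 i <= c ord0 i)%R] `&`
      ~` [set x : 'rV[R]_n | (x ord0 i <= a ord0 i)%R]) `&`
    [set x : 'rV[R]_n | forall j, j \in s -> (a ord0 j < x ord0 j <= c ord0 j)%R]).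
    apply: caratheodory_measurable_setI => //.
    apply: caratheodory_measurable_setI; first exact: halfspace_caratheodory.
    exact/caratheodory_measurable_setC/halfspace_caratheodory.
  apply/seteqP; split => [x /= xs|x /= [[xc /negP xa] xs] j].
    split; last by move=> j js; apply: xs; rewrite inE js orbT.
    by have /andP[ax xc] := xs i (mem_head _ _); split => //; apply/negP;
      rewrite -ltNge.
  by rewrite inE => /predU1P[->|/xs//]; rewrite xc ltNge xa.
rewrite (_ : box a c = [set x | forall i, i \in enum 'I_n ->
    (a ord0 i < x ord0 i <= c ord0 i)%R]); first exact: h.
by apply/seteqP; split => [x xac i _|x xac i]; [exact: xac|apply: xac;
  rewrite mem_enum].
Qed.

Lemma indic_lebesgue_measurable A : (@lebesgue_outer R n).-caratheodory A ->
  lebesgue_measurable_fun (fun x => (\1_A x)%:E : \bar R).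
Proof.
move=> mA Y _; have -> : (fun x => (\1_A x)%:E : \bar R) @^-1` Y =
    \1_A @^-1` [set r : R | Y r%:E] by [].
rewrite preimage_indic; case: ifPn => _; case: ifPn => _ //.
- rewrite -setC0; exact/caratheodory_measurable_setC/caratheodory_measurable_set0.
- exact/caratheodory_measurable_setC.
- exact/caratheodory_measurable_set0.
Qed.

(** The indicator exceeds [l] exactly on [A] if [l < 1], and nowhere if
    [1 <= l]. *)
Lemma rearrangement_indic A (t s : R) : lebesgue_outer A = t%:E -> (0 <= s)%R ->
  rearrangement (fun x => (\1_A x)%:E) s = (if (s < t)%R then 1 else 0).
Proof.
move=> At s0; rewrite /rearrangement; apply/eqP; rewrite eq_le.
have small (l : R) : (0 <= l)%R -> (l < 1)%R ->
    [set x | l%:E < `|(\1_A x)%:E|] = A.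
  move=> l0 l1; apply/seteqP; split=> [x /=|x Ax /=]; rewrite indicE.
    by case: (boolP (x \in A)) => [/set_mem//|_]; rewrite normr0 lte_fin ltNge l0.
  by rewrite mem_set// normr1 lte_fin.
have big : [set x | (1%R : R)%:E < `|(\1_A x)%:E|] = set0.
  apply/seteqP; split=> [x /=|//]; rewrite indicE.
  by case: (x \in A); rewrite /= ?normr0 ?normr1 lte_fin ?ltxx// ltr10.
case: ltP => st; apply/andP; split.
- apply: ereal_inf_lbound; exists 1%R => //; split => //.
  by rewrite big lebesgue_outer0 lee_fin.
- apply: le_ereal_inf_tmp => _ [l [l0 ls] <-]; rewrite lee_fin leNgt.
  by apply/negP => l1; move: ls; rewrite small// At lee_fin leNgt st.
- apply: ereal_inf_lbound; exists 0%R => //; split => //.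
  by rewrite small// ?At ?lee_fin.
- by apply: le_ereal_inf_tmp => _ [l [l0 ls] <-]; rewrite lee_fin.
Qed.

Lemma exists_rearrangement_step (t : R) : (0 < t)%R ->
  exists2 f : 'rV[R]_n -> \bar R, lebesgue_measurable_fun f &
    forall s, (0 <= s)%R -> rearrangement f s = (if (s < t)%R then 1 else 0).
Proof.
move=> t0; pose c : 'rV[R]_n := set_coord (const_mx 1%R) ord0 t.
exists (fun x => (\1_(box 0%R c) x)%:E).
  exact/indic_lebesgue_measurable/box_caratheodory.
move=> s s0; apply: rearrangement_indic => //.
rewrite lebesgue_outer_box /box_volume big_ord_recl big1 => [|i _].
  by rewrite !mxE eqxx subr0 mulr1 max_l// ltW.
by rewrite !mxE/= subr0 max_l.
Qed.

End lebesgue_outer_measure.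

(** * The best constant *)

Section division.
Context {R : realType}.
Implicit Types (x y : \bar R) (C : R).

(** The conventions for division make the quotient vanish when [y = +oo], and
    when [x = y = 0]. *)
Lemma dive_le C x y : (0 <= C)%R -> 0 <= x -> 0 <= y ->
  (y < +oo -> x <= C%:E * y) -> x / y <= C%:E.
Proof.
move=> C0; case: y => [r| |]// x0; last first.
  by move=> _ _; rewrite invey mule0 lee_fin.
rewrite lee_fin le_eqVlt => /predU1P[<-|r0] /(_ (ltry _)) h.
  move: h; rewrite mule0 => h.
  have -> : x = 0 by apply/eqP; rewrite eq_le h x0.
  by rewrite mul0e lee_fin.
by rewrite inver gt_eqF// lee_pdivrMr// muleC.
Qed.

Lemma le_dive C x y : 0 <= x -> 0 <= y -> y < +oo -> x / y <= C%:E ->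
  x <= C%:E * y.
Proof.
case: y => [r| |]// x0; rewrite lee_fin le_eqVlt => /predU1P[<-|r0] _.
  rewrite inve0 mule0; move: x0; rewrite le_eqVlt => /predU1P[<-//|x0].
  by rewrite gt0_muley// leye_eq.
by rewrite inver gt_eqF// lee_pdivrMr.
Qed.

End division.

Lemma rearrangement_decreasing (R : realType) (n : nat) (f : 'rV[R]_n -> \bar R) :
  decreasing_nneg (rearrangement f).
Proof.
split=> [x _|x y _ xy].
  by apply: le_ereal_inf_tmp => _ [l [l0 _] <-]; rewrite lee_fin.
apply: ereal_inf_le_tmp => _ [l [l0 lx] <-]; exists l => //; split=> //.
by apply: le_trans lx _; rewrite lee_fin.
Qed.

Section best_constant.
Context {R : realType}.
Local Notation mu := (@completed_lebesgue_measure R).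
Variables (m p q : R) (b u v w : R -> R).

Lemma SnormE (g : R -> \bar R) : Snorm m p v g =
  (\int[mu]_(x in `]0%R, +oo[)
    ((\int[mu]_(tau in `]0%R, x[) (g tau `^ p)) `^ (m / p) * (v x)%:E)) `^ m^-1.
Proof.
rewrite /Snorm /wnorm; congr (_ `^ _); apply: eq_integral => x _.
by rewrite /Lp /wnorm wint_one -poweRrM (mulrC m).
Qed.

Lemma bestKE n : bestK n m p q b u v w = ereal_sup
  [set Nnorm q b u w (rearrangement f) / Snorm m p v (rearrangement f) |
   f in [set f : 'rV[R]_n -> \bar R | lebesgue_measurable_fun f]].
Proof. by congr ereal_sup; apply: eq_imagel => f _; rewrite SnormE. Qed.

Hypotheses (m0 : (0 < m)%R) (m1 : (m <= 1)%R) (p0 : (0 < p)%R) (p1 : (p <= 1)%R)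
  (q1 : (1 < q)%R).
Hypotheses (wb : weight b) (wu : weight u) (wv : Wmp m p v) (ww : weight w).
Hypothesis B0 : forall t, (0 < t)%R -> 0 < primitive b t /\ primitive b t < +oo.

Let wv' : weight v. Proof. by case: wv. Qed.

Lemma v1_lty t : (0 < t)%R -> v1 m p v t < +oo.
Proof.
move=> t0; case: wv => _ /(_ t t0) fin _ _; rewrite /v1.
have a0 : 0 <= \int[mu]_(s in `]0%R, t[) (v s * s `^ (m / p))%:E.
  apply: integral_ge0 => s /oo_itvP[s0 _]; rewrite lee_fin mulr_ge0 ?powR_ge0//.
  by case: wv' => _ + _; exact.
have c0 : 0 <= \int[mu]_(s in `]t, +oo[) (v s)%:E.
  apply: integral_ge0 => s /(cy_sub_pos t0)/pos_itvP s0; rewrite lee_fin.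
  by case: wv' => _ + _; exact.
apply: lte_add_pinfty; first by apply: le_lt_trans fin; rewrite leeDl.
apply: lte_mul_pinfty; [by rewrite lee_fin powR_ge0|by []|].
by apply: le_lt_trans fin; rewrite leeDr.
Qed.

(** Characteristic functions of (0, t) are admissible. *)
Lemma ratio_step_le_bestK n t : (0 < n)%N -> (0 < t)%R ->
  Nnorm q b u w (step t) / (v1 m p v t `^ m^-1) <= bestK n m p q b u v w.
Proof.
case: n => // n _ t0; rewrite bestKE.
have [f mf fstep] := @exists_rearrangement_step R n t t0.
apply: le_trans (ereal_sup_ubound _); last by exists f.
have df := rearrangement_decreasing f; have dt := @step_decreasing R t.
have eq_step y : (0 < y)%R -> rearrangement f y = step t y.
  by move=> y0; rewrite fstep// ltW.
rewrite -(Snorm_step m p0 wv' t0).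
have -> : Snorm m p v (rearrangement f) = Snorm m p v (step t).
  apply/eqP; rewrite eq_le; apply/andP.
  by split; apply: (le_Snorm m0 p0 wv') => // y y0; rewrite eq_step.
apply: lee_wpmul2r; first by rewrite inve_ge0 Snorm_ge0.
by apply: (le_Nnorm q1 wb wu ww B0) => // y y0; rewrite eq_step.
Qed.

Lemma bestK_le n (C : R) : (0 <= C)%R ->
  (forall t, (0 < t)%R ->
    Nnorm q b u w (step t) / (v1 m p v t `^ m^-1) <= C%:E) ->
  bestK n m p q b u v w <= (2 * C)%:E.
Proof.
move=> C0 hC; rewrite bestKE; apply: ge_ereal_sup => _ [f _ <-].
have df := rearrangement_decreasing f.
apply: dive_le; [by rewrite mulr_ge0|exact: Nnorm_ge0|exact: Snorm_ge0|].
apply: (Nnorm_le_Snorm m0 m1 p0 p1 q1 wb wu wv' ww B0 _ C0 df); first by case: wv.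
move=> t t0; rewrite Snorm_step//.
apply: le_dive; [exact: Nnorm_ge0|exact: poweR_ge0| |exact: hC].
by rewrite poweR_lty// v1_lty.
Qed.

End best_constant.

Set Strict Implicit.
Unset Implicit Arguments.

Theorem theorem3p2 (R : realType) (m p q : R)
    (hm0 : (0 < m)%R) (hm1 : (m <= 1)%R) (hp0 : (0 < p)%R) (hp1 : (p <= 1)%R)
    (hq : (1 < q)%R) :
  exists lam : R, (0 < lam)%R /\
  forall (n : nat) (b u v w : R -> R),
    (0 < n)%N ->
    weight b ->
    (forall s t : R, (0 < s)%R -> (s <= t)%R -> (b t <= b s)%R) ->
    (forall t : R, (0 < t)%R -> 0 < primitive b t /\ primitive b t < +oo) ->
    weight u -> {within `]0%R, +oo[%classic, continuous u} ->
    Wmp m p v ->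
    weight w ->
    equiv_with lam (bestK n m p q b u v w)
     (ereal_sup [set
        (v1 m p v t `^ m^-1)^-1 *
        (\int[completed_lebesgue_measure]_(x in `]0%R, t[)
           (ereal_sup [set (u tau `^ q)%:E | tau in `[x, t]%classic]
            * (w x)%:E)) `^ q^-1
      | t in `]0%R, +oo[%classic]
    + ereal_sup [set
        primitive b t / v1 m p v t `^ m^-1 *
        ereal_sup [set (u tau)%:E / primitive b tau
                  | tau in `[t, +oo[%classic] *
        (\int[completed_lebesgue_measure]_(x in `]0%R, t[) (w x)%:E) `^ q^-1
      | t in `]0%R, +oo[%classic]
    + ereal_sup [set
        primitive b t / v1 m p v t `^ m^-1 *
        (\int[completed_lebesgue_measure]_(x in `]t, +oo[)
           (ereal_sup [set ((u tau)%:E / primitive b tau) `^ q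
                      | tau in `[x, +oo[%classic]
            * (w x)%:E)) `^ q^-1
      | t in `]0%R, +oo[%classic]).
Proof.
(* Each of the three terms is at most [K], and [K] is at most twice their sum. *)
exists 3%R; split => // n b u v w n0 wb _ B0 wu _ Wv ww.
pose K := bestK n m p q b u v w.
pose V t := (v1 m p v t `^ m^-1)^-1.
pose t1 t := V t * head_sup_integral q u w t `^ q^-1.
pose t2 t := primitive b t * V t * sup_u_over_B b u t * head_integral w t `^ q^-1.
pose t3 t := primitive b t * V t * tail_sup_integral q b u w t `^ q^-1.
rewrite -[X in equiv_with _ X]/K.
rewrite -[X in equiv_with _ _ (X + _ + _)]/
  (ereal_sup [set t1 t | t in `]0%R, +oo[%classic]).
rewrite -[X in equiv_with _ _ (_ + X + _)]/
  (ereal_sup [set t2 t | t in `]0%R, +oo[%classic]).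
rewrite -[X in equiv_with _ _ (_ + _ + X)]/
  (ereal_sup [set t3 t | t in `]0%R, +oo[%classic]).
set A1 := ereal_sup _; set A2 := ereal_sup _; set A3 := ereal_sup _.
have V0 t : 0 <= V t by rewrite inve_ge0 poweR_ge0.
have t10 t : 0 <= t1 t by rewrite mule_ge0 ?poweR_ge0.
have t20 t : (0 < t)%R -> 0 <= t2 t.
  by move=> t0; rewrite !mule_ge0 ?poweR_ge0// ?(sup_u_over_B_ge0 wu B0)//
    (primitive_ge0 B0).
have t30 t : (0 < t)%R -> 0 <= t3 t.
  by move=> t0; rewrite !mule_ge0 ?poweR_ge0// (primitive_ge0 B0).
have D1 : `]0%R, +oo[%classic (1%R : R) by apply/pos_itvP.
have A10 : 0 <= A1 by apply: le_trans (t10 1%R) (ereal_sup_ubound _); exists 1%R.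
have A20 : 0 <= A2 by apply: le_trans (t20 1%R ltr01) (ereal_sup_ubound _);
  exists 1%R.
have A30 : 0 <= A3 by apply: le_trans (t30 1%R ltr01) (ereal_sup_ubound _);
  exists 1%R.
have E2 t : t2 t =
    primitive b t * sup_u_over_B b u t * head_integral w t `^ q^-1 * V t.
  by rewrite /t2 -!muleA; congr (_ * _); rewrite muleC -!muleA.
have E3 t : t3 t = primitive b t * tail_sup_integral q b u w t `^ q^-1 * V t.
  by rewrite /t3 -!muleA; congr (_ * _); rewrite muleC.
split; last first.
  have -> : 3%:E * K = K + K + K.
    have K0 : 0 <= K.
      apply: le_trans (ratio_step_le_bestK hm0 hp0 hq wb wu Wv ww B0 n0 ltr01).
      by rewrite mule_ge0 ?Nnorm_ge0 ?inve_ge0 ?poweR_ge0.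
    move: K0; case: K => [k| |]// _; last by rewrite gt0_muley ?lte_fin.
    by rewrite -EFinM -!EFinD; congr EFin; ring.
  have toK (F : R -> \bar R) :
      (forall t, (0 < t)%R -> F t <= Nnorm q b u w (step t) * V t) ->
      ereal_sup [set F t | t in `]0%R, +oo[%classic] <= K.
    move=> h; apply: ge_ereal_sup => _ [t /pos_itvP t0 <-];
      apply: le_trans (h t t0) _.
    exact: (ratio_step_le_bestK hm0 hp0 hq wb wu Wv ww B0 n0 t0).
  apply: leeD; first apply: leeD.
  - apply: toK => t t0; rewrite /t1 muleC; apply: lee_wpmul2r => //.
    exact: (head_sup_le_Nnorm hq wb wu ww B0 t0).
  - apply: toK => t t0; rewrite E2; apply: lee_wpmul2r => //.
    exact: (head_le_Nnorm hq wb wu ww B0 t0).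
  - apply: toK => t t0; rewrite E3; apply: lee_wpmul2r => //.
    exact: (tail_sup_le_Nnorm hq wb wu ww B0 t0).
have S0 : 0 <= A1 + A2 + A3 := adde_ge0 (adde_ge0 A10 A20) A30.
have step_le t : (0 < t)%R -> Nnorm q b u w (step t) * V t <= A1 + A2 + A3.
  move=> t0.
  apply: le_trans (lee_wpmul2r (V0 t) (Nnorm_step_le hq wb wu ww B0 t0)) _.
  have B'0 := primitive_ge0 B0 t0; have s0 := sup_u_over_B_ge0 wu B0 t0.
  have j10 : 0 <= head_sup_integral q u w t `^ q^-1 := poweR_ge0 _ _.
  have j20 := mule_ge0 (mule_ge0 B'0 s0) (poweR_ge0 (head_integral w t) q^-1%R).
  have j30 := mule_ge0 B'0 (poweR_ge0 (tail_sup_integral q b u w t) q^-1%R).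
  rewrite (@ge0_muleDl _ _ _ _ (adde_ge0 j10 j20) j30) (@ge0_muleDl _ _ _ _ j10 j20).
  rewrite -E2 -E3 [X in X + _ + _]muleC.
  by apply: leeD; [apply: leeD|]; apply: ereal_sup_ubound; exists t => //;
    apply/pos_itvP.
move: S0 step_le; case: (A1 + A2 + A3) => [C| |]// C0 step_le; last first.
  by rewrite gt0_muley ?leey// lte_fin.
apply: (@le_trans _ _ (2 * C)%:E); last first.
  by rewrite -EFinM lee_fin ler_wpM2r// ler_nat.
exact: (bestK_le hm0 hm1 hp0 hp1 hq wb wu Wv ww B0 n C0 step_le).
Qed.
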